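(* Let $p_1,p_2,q$ be distinct primes with $p_1\equiv p_2\equiv -q\equiv1\pmod 4$, $k=\mathbb{Q}(\sqrt{p_1p_2q},i)$, $\mathbb{K}_3=k(\sqrt q)$, and $\epsilon_{p_1p_2q}=x+y\sqrt{p_1p_2q}$ with $x,y\in\mathbb{Z}$. Assume $N(\epsilon_{p_1p_2})=1$. 1. If $x\pm1$ is a square in $\mathbb{N}$, then $\kappa_{\mathbb{K}_3}=\langle[\mathcal H_1\mathcal H_2],[\mathcal H_3\mathcal H_4]\rangle$. 2. If $p_1(x\pm1)$ or $2p_1(x\pm1)$ is a square in $\mathbb{N}$, then $\kappa_{\mathbb{K}_3}=\langle[\mathcal H_3\mathcal H_4]\rangle$. 3. If $p_2(x\pm1)$ or $2p_2(x\pm1)$ is a square in $\mathbb{N}$, then $\kappa_{\mathbb{K}_3}=\langle[\mathcal H_1\mathcal H_2]\rangle$. 4. If $q(x\pm1)$ or $2q(x\pm1)$ is a square in $\mathbb{N}$, then $\kappa_{\mathbb{K}_3}=\langle[\mathcal H_1\mathcal H_2]\rangle=\langle[\mathcal H_3\mathcal H_4]\rangle$.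
   Context: $i=\sqrt{-1}$; $\epsilon_m>1$ is the fundamental unit of $\mathbb{Q}(\sqrt m)$ and $N(\epsilon_m)$ its norm to $\mathbb{Q}$. For integers $c,u$, ''$c(u\pm1)$ is a square in $\mathbb{N}$'' means at least one of $c(u+1)$, $c(u-1)$ is the square of a natural number. Write $p_1=e^2+4f^2$, $p_2=g^2+4h^2$ ($e,f,g,h\in\mathbb{N}$), $\pi_1=e+2if$, $\pi_2=e-2if$, $\pi_3=g+2ih$, $\pi_4=g-2ih$; $\mathcal H_j$ is the prime ideal of $k$ above $\pi_j$ and $[\cdot]$ denotes ideal class in $k$. $\kappa_{\mathbb{K}_3}$ is the kernel of the map $\mathrm{Cl}(k)\to\mathrm{Cl}(\mathbb{K}_3)$ induced by extension of ideals. *)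

(* Defs.v *)
From HB Require Import structures.
From mathcomp Require Import all_boot all_order all_algebra all_field.
From mathcomp Require Import boolp classical_sets.

Set Implicit Arguments.
Unset Strict Implicit.
Unset Printing Implicit Defensive.

Import Order.TTheory GRing.Theory Num.Theory.
Local Open Scope ring_scope.
Local Open Scope classical_set_scope.

(* Number fields are realised as subsets of the complex algebraic numbers. *)

Definition is_subfield (F : set algC) : Prop :=
  [/\ F 1, forall x y, F x -> F y -> F (x - y)
    & forall x y, F x -> F y -> F (x / y)].

(* Every subfield of algC contains the rationals, so [field_gen S] is Q(S). *)
Definition field_gen (S : set algC) : set algC := smallest is_subfield S.

Definition sqrtn (m : nat) : algC := sqrtC m%:R.

Definition ring_of_int (K : set algC) : set algC :=
  [set x | K x /\ x \in Aint].

Definition int_unit (K : set algC) (u : algC) : Prop :=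
  [/\ u != 0, ring_of_int K u & ring_of_int K u^-1].

Definition quad_field (m : nat) : set algC := field_gen [set sqrtn m].

(* [1 < eps] in algC includes that eps is real. *)
Definition fundamental_unit (m : nat) (eps : algC) : Prop :=
  [/\ int_unit (quad_field m) eps, 1 < eps
    & forall u, int_unit (quad_field m) u ->
        exists n : int, u = eps ^ n \/ u = - eps ^ n].

(* For m not a square: [nu] is the product of the two conjugates of [z] in
   Q(sqrt m). *)
Definition quad_norm_eq (m : nat) (z : algC) (nu : rat) : Prop :=
  exists a b : rat, z = ratr a + ratr b * sqrtn m
    /\ ratr nu = (ratr a + ratr b * sqrtn m) * (ratr a - ratr b * sqrtn m).

Definition add_subgroup (I : set algC) : Prop :=
  I 0 /\ forall x y, I x -> I y -> I (x - y).

Definition int_submodule (K I : set algC) : Prop :=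
  add_subgroup I /\ forall a x, ring_of_int K a -> I x -> I (a * x).

Definition fractional_ideal (K I : set algC) : Prop :=
  [/\ int_submodule K I, I `<=` K, exists2 x, I x & x != 0
    & exists d, [/\ ring_of_int K d, d != 0
                  & forall x, I x -> ring_of_int K (d * x)]].

Definition scale_set (a : algC) (I : set algC) : set algC :=
  [set a * x | x in I].

Definition ideal_mul (I J : set algC) : set algC :=
  smallest add_subgroup [set x * y | x in I & y in J].

Definition ideal_class (K I : set algC) : set (set algC) :=
  [set J | exists a, [/\ K a, a != 0 & J = scale_set a I]].

Definition class_group (K : set algC) : set (set (set algC)) :=
  [set ideal_class K I | I in fractional_ideal K].

(* The group law is [I][J] = [IJ], with identity the class of the ring of
   integers. *)
Definition class_subgroup (K : set algC) (G : set (set (set algC))) : Prop :=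
  [/\ G `<=` class_group K,
      G (ideal_class K (ring_of_int K)),
      forall I J, fractional_ideal K I -> fractional_ideal K J ->
        G (ideal_class K I) -> G (ideal_class K J) ->
        G (ideal_class K (ideal_mul I J))
    & forall I J, fractional_ideal K I -> fractional_ideal K J ->
        ideal_class K (ideal_mul I J) = ideal_class K (ring_of_int K) ->
        G (ideal_class K I) -> G (ideal_class K J)].

Definition class_gen (K : set algC) (S : set (set (set algC))) :
    set (set (set algC)) :=
  smallest (class_subgroup K) S.

Definition ideal_ext (L I : set algC) : set algC :=
  smallest (int_submodule L) I.

Definition capitulation_kernel (K L : set algC) : set (set (set algC)) :=
  [set ideal_class K I | I in
     [set I | fractional_ideal K I /\
        ideal_class L (ideal_ext L I) = ideal_class L (ring_of_int L)]].

Definition prime_ideal_of (K P : set algC) : Prop :=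
  [/\ int_submodule K P, P `<=` ring_of_int K, exists2 x, P x & x != 0,
      ~ P 1
    & forall a b, ring_of_int K a -> ring_of_int K b ->
        P (a * b) -> P a \/ P b].

Definition gauss_field : set algC := field_gen [set 'i].

(* P is a prime ideal of K whose contraction to Z[i] is the ideal (pi). *)
Definition prime_lying_above (K P : set algC) (pi : algC) : Prop :=
  prime_ideal_of K P /\
  P `&` ring_of_int gauss_field = scale_set pi (ring_of_int gauss_field).

Definition pm_square (c : nat) (u : int) : Prop :=
  exists n : nat, c%:Z * (u + 1) = n%:Z ^+ 2 \/ c%:Z * (u - 1) = n%:Z ^+ 2.

Definition field_k (p1 p2 q : nat) : set algC :=
  field_gen [set sqrtn (p1 * p2 * q); 'i].

Definition field_K3 (p1 p2 q : nat) : set algC :=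
  field_gen (field_k p1 p2 q `|` [set sqrtn q]).

(* Main.v *)
From HB Require Import structures.
Require Import Defs.
From mathcomp Require Import all_boot all_order all_algebra all_field.
From mathcomp Require Import boolp classical_sets.
From mathcomp Require Import ring zify.

(* Write m = p1 p2, d = m q, L = K_3 = Q(i, sqrt m, sqrt q), and let s generate
   Gal(L/k), so that s negates sqrt m and sqrt q.  If v is a unit of norm one
   in a real quadratic field, then v (2 + Tr v) = (1 + v)^2, so v is a positive
   integer up to squares, and (2 + Tr v)(Tr v - 2) being D times a square
   leaves few possibilities.  For the fundamental unit eta of Q(sqrt m) this
   gives eta = b^2 / p1 = b'^2 / p2 with b, b' in L, whence H1 H2 and H3 H4
   become (b) and (b') in L.

   Conversely, let I O_L = (a).  Then u = s(a)/a is a unit of relative norm one,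
   and replacing a by a/u replaces u by u^3.  With t generating
   Gal(L/Q(i, sqrt m)), one has u^2 = (u t(u)) (u / t(u)), where the factors
   are units of Q(i, sqrt m) and Q(i, sqrt q); comparing them with their complex
   conjugates shows that they are, up to sign, a power of eta and a positive
   unit of Q(sqrt q).  As 2, p1 and 2 p1 are not squares in L up to sign, u is
   up to sign g / s(g), where g is a power of b times a square root of one or
   two times a unit of Q(sqrt q).  Hence a lies in k^* b^e b'^f O_L^*.  Since L
   contains (1 + sqrt(-q))/2, of trace one over k, I is recovered from I O_L,
   so the kernel is generated by [H1 H2] and [H3 H4] in all cases.

   Finally, if c (x +- 1) or 2 c (x +- 1) is a square, then c is a square in k
   up to units; for c = p1, p2 and q this makes H1 H2, H3 H4 and H1 H2 H3 H4
   principal in k. *)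

Set Implicit Arguments.
Unset Strict Implicit.
Unset Printing Implicit Defensive.

Import Order.TTheory GRing.Theory Num.Theory.
Local Open Scope ring_scope.
Local Open Scope classical_set_scope.

(** * Automorphisms of algC acting on square roots *)

(** The minimal polynomial of [z] over the rationals is [X^2 - z^2], so [z -> -z] defines an
    automorphism of the number field Q(z), and it extends to [algC]. *)
Lemma quadratic_aut (z : algC) :
    z ^+ 2 \in Crat -> z \notin Crat ->
  exists nu : {rmorphism algC -> algC}, nu z = - z.
Proof.
move=> /CratP[r Dr] z_irr.
have [Qn [QnC [[|zn []] // [Dz]]] genQn] := num_field_exists [:: z].
have homQn1: kHom 1 1 (\1%VF : 'End(Qn)) by rewrite kHom1.
have Dzn : zn ^+ 2 = r%:A.
  by apply: (fmorph_inj QnC); rewrite rmorphXn /= Dz Dr alg_num_field fmorph_rat.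
pose p : {poly Qn} := 'X^2 - (r%:A)%:P.
have sp : size p = 3%N.
  by rewrite /p size_polyDl ?size_polyXn // size_polyN (leq_ltn_trans (size_polyC_leq1 _)).
have pmon : p \is monic.
  rewrite monicE lead_coefDl ?lead_coefXn //.
  by rewrite size_polyXn size_polyN (leq_ltn_trans (size_polyC_leq1 _)).
have pO : p \is a polyOver 1%VS.
  by rewrite rpredB ?rpredX ?polyOverX // polyOverC rpredZ // mem1v.
have pz : root p zn by rewrite rootE !hornerE Dzn subrr.
have dvd := minPoly_dvdp pO pz.
have minE : minPoly 1 zn = p.
  (* The minimal polynomial divides [p]; a smaller size would make [z] rational. *)
  apply/eqP; rewrite -eqp_monic ?monic_minPoly // -dvdp_size_eqp //.
  have : (size (minPoly 1 zn) <= 3)%N by rewrite -sp dvdp_leq // monic_neq0.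
  rewrite sp size_minPoly leq_eqVlt => /orP[//|].
  rewrite 2!ltnS => deg; exfalso; move/negP: z_irr; apply.
  have /vlineP[b Db] : zn \in 1%VS.
    by rewrite -adjoin_deg_eq1 eqn_leq deg.
  by rewrite -Dz Db alg_num_field fmorph_rat Crat_rat.
pose phi := kHomExtend 1 \1 zn (- zn).
have rt : root (map_poly \1%VF (minPoly 1 zn)) (- zn).
  by rewrite lfun1_poly minE rootE !hornerE sqrrN Dzn subrr.
have phim : monoid_morphism phi.
  by apply/kHom_monoid_morphism; rewrite -genQn span_seq1 /= kHomExtendP.
pose phimM := GRing.isMonoidMorphism.Build _ _ phi phim.
pose phiRM : {rmorphism _ -> _} := HB.pack (fun_of_lfun phi) phimM.
have [nu Dnu] := extend_algC_subfield_aut QnC phiRM.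
exists nu; rewrite -Dz -Dnu /= /phi (kHomExtend_val homQn1) ?rmorphN //.
Qed.

Lemma rmorph_sqr_sign (nu : {rmorphism algC -> algC}) (z : algC) :
  z ^+ 2 \in Crat -> nu z = z \/ nu z = - z.
Proof.
move=> /CratP[r Dr]; have : nu z ^+ 2 = z ^+ 2.
  by rewrite -rmorphXn /= Dr fmorph_rat.
by move/eqP; rewrite eqf_sqr => /orP[] /eqP ->; [left|right].
Qed.

(** If [nu] negates ['i], composing it with complex conjugation repairs this without changing its
    action on real numbers. *)
Lemma rmorph_fixing_i (nu : {rmorphism algC -> algC}) :
  exists nu' : {rmorphism algC -> algC}, nu' 'i = 'i /\
    forall z, z^* = z -> nu' z = nu z.
Proof.
have [] := @rmorph_sqr_sign nu 'i; first by rewrite sqrCi rpredN rpred1.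
  by move=> nui; exists nu.
move=> nui; exists (nu \o Num.conj)%FUN; split=> [|z zR] /=.
  by rewrite conjCi rmorphN nui opprK.
by rewrite zR.
Qed.

(* Among three automorphisms moving respectively [a], [b] and [a * b], two
   generate the sign group of the pair [(a, b)]. *)
Lemma biquadratic_auts (a b : algC) :
    a ^+ 2 \in Crat -> b ^+ 2 \in Crat -> a^* = a -> b^* = b ->
    a \notin Crat -> b \notin Crat -> a * b \notin Crat ->
  exists s t : {rmorphism algC -> algC},
    [/\ s 'i = 'i, s a = - a & s b = - b] /\
    [/\ t 'i = 'i, t a = - a & t b = b].
Proof.
move=> a2 b2 aR bR aQ bQ abQ.
have ab2 : (a * b) ^+ 2 \in Crat by rewrite exprMn rpredM.
have [f fa] := quadratic_aut a2 aQ; have [g gb] := quadratic_aut b2 bQ.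
have [h hab] := quadratic_aut ab2 abQ.
have a0 : a != 0 by apply: contraNneq aQ => ->; rewrite rpred0.
have b0 : b != 0 by apply: contraNneq bQ => ->; rewrite rpred0.
have ab0 : a * b != 0 by rewrite mulf_neq0.
have neN x : x != 0 :> algC -> x <> - x.
  by move=> x0 /eqP; rewrite -subr_eq0 opprK -mulr2n mulrn_eq0 /= (negPf x0).
(* Since [a] and [b] are real, the two automorphisms can be made to fix ['i] afterwards. *)
suff [s [t [[sa sb] [ta tb]]]] : exists s t : {rmorphism algC -> algC},
    (s a = - a /\ s b = - b) /\ (t a = - a /\ t b = b).
  have [s' [s'i s'E]] := rmorph_fixing_i s; have [t' [t'i t'E]] := rmorph_fixing_i t.
  by exists s', t'; split; split=> //; rewrite ?s'E ?t'E.
(* Negating [a * b] means negating exactly one of the two factors. *)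
have hs : (h a = a /\ h b = - b) \/ (h a = - a /\ h b = b).
  move: hab; rewrite rmorphM.
  have [->|->] := rmorph_sqr_sign h a2; have [->|->] := rmorph_sqr_sign h b2.
  - by move/(neN _ ab0).
  - by left.
  - by right.
  - by rewrite mulrNN => /(neN _ ab0).
(* [f] negates [a]. If it fixes [b], it serves as [t], and [g] or [f \o g] as [s]; otherwise it
   serves as [s], and [h] or [f \o h] as [t]. *)
have [fb|fb] := rmorph_sqr_sign f b2.
  have [ga|ga] := rmorph_sqr_sign g a2.
    by exists (f \o g)%FUN, f; rewrite /= ga gb rmorphN fa fb.
  by exists g, f.
case: hs => -[ha hb].
  by exists f, (f \o h)%FUN; rewrite /= ha hb rmorphN fa fb opprK.
by exists f, h.
Qed.

(** * Parity of valuations *)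

(** Substituting [X^2] in the minimal polynomial of [z ^+ 2] gives a monic integral polynomial with
    root [z]. *)
Lemma Aint_sqr (z : algC) : z ^+ 2 \in Aint -> z \in Aint.
Proof.
move=> z2; have mon : minCpoly (z ^+ 2) \is monic by have [p [-> ? _]] := minCpolyP (z ^+ 2);
  rewrite map_monic.
apply: (@root_monic_Aint (minCpoly (z ^+ 2) \Po 'X^2)).
- by rewrite rootE horner_comp hornerXn -rootE root_minCpoly.
- rewrite monicE lead_coef_comp ?size_polyXn // lead_coefXn expr1n mulr1.
  by rewrite -monicE.
- by apply: polyOver_comp; rewrite ?rpredX ?polyOverX.
Qed.

Lemma Crat_sqr_int (z : algC) : z \in Crat -> z ^+ 2 \in Num.int -> z \in Num.int.
Proof. by move=> zQ z2; rewrite Cint_rat_Aint // Aint_sqr // Aint_Cint. Qed.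

Lemma natr_sqr_absz (k : int) : (`|k| ^ 2)%:R = k%:~R ^+ 2 :> algC.
Proof.
rewrite natrX; case: k => n; first by rewrite absz_nat.
by rewrite NegzE abszN absz_nat rmorphN sqrrN.
Qed.

(** For [D > 0] this expresses that [D] is squarefree, in the form that [radical_int] consumes. *)
Definition radical_nat (D : nat) := forall N, (D %| N ^ 2 -> D %| N)%N.

Lemma radical_prime p : prime p -> radical_nat p.
Proof. by move=> pp N; rewrite Euclid_dvdX // andbT. Qed.

Lemma radical_mul a b :
  coprime a b -> radical_nat a -> radical_nat b -> radical_nat (a * b)%N.
Proof.
move=> cab ra rb N; rewrite !Gauss_dvd // => /andP[aN bN].
by apply/andP; split; [apply: ra | apply: rb].
Qed.

(** The square of [D * z] is [D] times an integer, so [D * z] is an integer whose square is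
    divisible by [D]; squarefreeness makes it divisible by [D] itself. *)
Lemma radical_int (D : nat) (z : algC) : (0 < D)%N -> radical_nat D ->
  z \in Crat -> D%:R * z ^+ 2 \in Num.int -> z \in Num.int.
Proof.
move=> D0 rD zQ /intrP[n Dn].
have D0' : D%:R != 0 :> algC by rewrite pnatr_eq0 -lt0n.
have : D%:R * z \in Num.int.
  apply: Crat_sqr_int; first by rewrite rpredM // rpred_nat.
  by rewrite exprMn expr2 -mulrA Dn rpredM // ?rpred_nat // intr_int.
case/intrP=> N DN.
have E : N ^+ 2 = D%:Z * n.
  apply/(@intr_inj algC); rewrite rmorphXn /= -DN rmorphM /= -Dn -pmulrn.
  by ring.
have dvd : (D %| `|N|)%N.
  by apply: rD; rewrite -abszX E abszM absz_nat dvdn_mulr.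
have /dvdzP[k Dk] : (D%:Z %| N)%Z by rewrite dvdzE absz_nat.
have -> : z = k%:~R.
  by apply: (mulfI D0'); rewrite DN Dk rmorphM /= mulrC pmulrn.
exact: intr_int.
Qed.

Lemma sqr_logn_even (n : nat) :
    (0 < n)%N -> (forall p, prime p -> ~~ odd (logn p n)) ->
  exists2 r, (0 < r)%N & n = (r ^ 2)%N.
Proof.
move=> n0 ev; pose r := (\prod_(p <- primes n) p ^ (logn p n)./2)%N.
have nE : n = (r ^ 2)%N.
  rewrite [n in LHS]prod_prime_decomp // prime_decompE big_map /= -mulnn -big_split /=.
  rewrite !big_seq; apply: eq_bigr => p; rewrite mem_primes => /andP[pp _].
  by rewrite -expnD addnn even_halfK // ev.
by exists r => //; rewrite lt0n; apply: contraTneq n0 => r0; rewrite nE r0.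
Qed.

Lemma Crat_sqr_logn (z : algC) (n : nat) (p : nat) :
  z \in Crat -> z ^+ 2 = n%:R -> ~~ odd (logn p n).
Proof.
move=> zQ z2; have /intrP[k Dk] : z \in Num.int.
  by rewrite Crat_sqr_int // z2 rpred_nat.
have -> : n = (`|k| ^ 2)%N.
  by apply/eqP; rewrite -(eqr_nat algC) -z2 Dk natr_sqr_absz.
by rewrite lognX oddM.
Qed.

(** The exponents [e] and [f] are the parities of the valuations of [n] at [a] and [b]:
    multiplication by [a ^ e * b ^ f] makes every valuation even. *)
Lemma logn_parity_class (a b n : nat) : prime a -> prime b -> a <> b ->
    (0 < n)%N ->
    (forall p, prime p -> p <> a -> p <> b -> ~~ odd (logn p n)) ->
  exists e f : bool, exists2 r, (0 < r)%N & (n * (a ^ e * b ^ f) = r ^ 2)%N.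
Proof.
move=> pa pb ab n0 ev; exists (odd (logn a n)), (odd (logn b n)).
have a0 e : (0 < a ^ e)%N by rewrite expn_gt0 prime_gt0.
have b0 e : (0 < b ^ e)%N by rewrite expn_gt0 prime_gt0.
have ab0 e f : (0 < a ^ e * b ^ f)%N by rewrite muln_gt0 a0 b0.
apply: sqr_logn_even => [|p pp]; first by rewrite muln_gt0 n0 ab0.
rewrite (lognM p n0 (ab0 _ _)) (lognM p (a0 _) (b0 _)) !lognX.
rewrite (logn_prime p pa) (logn_prime p pb) !oddD !oddM !oddb.
have [->|pa'] := eqVneq p a.
  have /eqP/negPf-> := ab; rewrite andbF addbF.
  by case: (odd (logn a n)).
have [->|pb'] := eqVneq p b; first by rewrite andbF /=; case: (odd (logn b n)).
by rewrite !andbF !addbF ev //; apply/eqP.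
Qed.

(** * Positive integers n for which n (n - 4) is D times a rational square *)

Section TraceSquare.

Variables (n D : nat) (t : algC).
Hypotheses (n0 : (0 < n)%N) (D0 : (0 < D)%N) (tQ : t \in Crat).
Hypothesis nt : n%:R * (n%:R - 4) = D%:R * t ^+ 2.

Lemma trace_sqr_ge4 : (4 <= n)%N.
Proof.
rewrite leqNgt; apply/negP => n4.
have t2 : 0 <= t ^+ 2 by rewrite real_exprn_even_ge0 // Creal_Crat.
have : 0 <= n%:R * (n%:R - 4) :> algC by rewrite nt mulr_ge0 // ler0n.
rewrite pmulr_rge0 ?ltr0n // subr_ge0 (ler_nat _ 4 n) => n4'.
by move: n4'; rewrite leqNgt n4.
Qed.

Lemma trace_sqr_nat : (n * (n - 4))%:R = D%:R * t ^+ 2.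
Proof. by rewrite natrM natrB ?trace_sqr_ge4. Qed.

(** An odd prime with odd valuation in [n] cannot divide [n - 4], since it would divide 4. If it is
    prime to [D], its valuation in [D n (n - 4)] is then odd, although this number is the square of
    [D t]. *)
Lemma trace_sqr_logn p :
  prime p -> ~~ (p %| 2 * D)%N -> ~~ odd (logn p n).
Proof.
move=> pp pD; have n4 := trace_sqr_ge4.
have [p2 pD'] : ~~ (p %| 2)%N /\ ~~ (p %| D)%N.
  by move: pD; rewrite Euclid_dvdM // negb_or => /andP.
(* The case [n = 4] is set apart, because [n - 4 = 0] has no valuation. *)
move: n4; rewrite leq_eqVlt => /orP[/eqP <-|n4].
  by rewrite (lognX p 2 2) oddM.
apply/negP => on.
have pn : (p %| n)%N by apply: contraTT on => pn; rewrite logn_coprime // prime_coprime.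
have pn4 : ~~ (p %| n - 4)%N.
  apply: contra p2 => pn4.
  have : (p %| 2 ^ 2)%N by rewrite -(dvdn_addr _ pn4) subnK // ltnW.
  by rewrite Euclid_dvdX // andbT.
have : ~~ odd (logn p (D * (n * (n - 4)))%N).
  apply: (@Crat_sqr_logn (D%:R * t)); first by rewrite rpredM // rpred_nat.
  by rewrite natrM trace_sqr_nat; ring.
rewrite !lognM ?muln_gt0 ?n0 ?subn_gt0 //.
rewrite (@logn_coprime p D) ?prime_coprime // (@logn_coprime p (n - 4)%N) ?prime_coprime //.
by rewrite add0n addn0 on.
Qed.

(** For an odd valuation, [n = 2 n1] turns the equation into [n1 (n1 - 2) = D v^2]. If [n1] is odd,
    the two sides are 3 and 1 modulo 4. If [n1 = 2 n2], it becomes [n2 (n2 - 1) = D v^2], whose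
    sides have odd and even valuation at 2. *)
Lemma trace_sqr_logn2 : radical_nat D -> (D %% 4 = 1)%N -> ~~ odd (logn 2 n).
Proof.
move=> rD D4; have : t \in Num.int.
  by rewrite (@radical_int D) // -trace_sqr_nat rpred_nat.
case/intrP=> T DT; pose u := `|T|%N.
have E : (n * (n - 4) = D * u ^ 2)%N.
  by apply/eqP; rewrite -(eqr_nat algC) trace_sqr_nat DT natrM natr_sqr_absz.
have n4 := trace_sqr_ge4; apply/negP => on.
have even2 x : odd (logn 2 x) -> exists y, x = (2 * y)%N.
  move=> ox; have : (2 %| x)%N.
    by apply: contraTT ox => pn; rewrite logn_coprime // prime_coprime.
  by case/dvdnP=> y ->; exists y; rewrite mulnC.
have Dodd : D = (4 * (D %/ 4) + 1)%N by lia.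
(* As [D] is odd, [z] is even, and a factor 4 cancels from both sides. *)
have halve x y z : (2 * x * (2 * y) = D * z ^ 2)%N ->
    exists v, (x * y = D * v ^ 2)%N.
  move=> xy; have : (2 %| D * z ^ 2)%N by rewrite -xy -mulnA dvdn_mulr.
  rewrite Gauss_dvdr; last by rewrite prime_coprime // dvdn2 Dodd; lia.
  rewrite Euclid_dvdX // andbT => /dvdnP[v zE]; exists v.
  by move: xy; rewrite zE; nia.
have [n1 nE] := even2 _ on.
have n1_ge : (2 <= n1)%N by lia.
have [v1 E1] : exists v, (n1 * (n1 - 2) = D * v ^ 2)%N.
  by apply: (halve _ _ u); rewrite -E nE; congr (_ * _)%N; lia.
have log2 x : (0 < x)%N -> logn 2 (2 * x) = (logn 2 x).+1.
  by move=> x0; rewrite lognM // logn_prime.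
have on1 : ~~ odd (logn 2 n1) by move: on; rewrite nE log2 //; lia.
have [odd1|ev1] := boolP (odd n1).
  have ov : odd (v1 ^ 2).
    have : odd (D * v1 ^ 2) by rewrite -E1 oddM odd1 oddB // odd1.
    by rewrite oddM => /andP[].
  rewrite oddX /= in ov; pose j := n1./2; pose l := v1./2.
  have n1E : n1 = (2 * j + 1)%N by rewrite /j; lia.
  have v1E : v1 = (2 * l + 1)%N by rewrite /l; lia.
  clearbody j l; move: E1; rewrite Dodd n1E v1E.
  move: (D %/ 4)%N => k; have -> : (2 * j + 1 - 2 = 2 * j - 1)%N by lia.
  have -> : ((2 * j + 1) * (2 * j - 1) = 4 * (j * j) - 1)%N by nia.
  have -> : ((4 * k + 1) * (2 * l + 1) ^ 2 = 4 * (4 * k * l ^ 2 + 4 * k * l + k + l ^ 2 + l) + 1)%N by ring.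
  lia.
have [n2 n1E] : exists n2, n1 = (2 * n2)%N by exists n1./2; lia.
have [v2 E2] : exists v, (n2 * (n2 - 1) = D * v ^ 2)%N.
  by apply: (halve _ _ v1); rewrite -E1 n1E; congr (_ * _)%N; lia.
have n2_0 : (0 < n2)%N by lia.
have on2 : odd (logn 2 n2) by move: on1; rewrite n1E log2 //; lia.
have [n3 n2E] := even2 _ on2.
have v0 : (0 < v2)%N.
  by rewrite lt0n; apply/eqP => v0; move: E2; rewrite v0; nia.
move: on2; have <- : logn 2 (n2 * (n2 - 1)) = logn 2 n2.
  rewrite lognM //; last by lia.
  by rewrite [X in (_ + X)%N]logn_coprime ?addn0 // prime_coprime // dvdn2; lia.
rewrite E2 lognM //; last by rewrite expn_gt0 v0.
rewrite logn_coprime; last by rewrite prime_coprime // dvdn2; lia.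
by rewrite lognX; lia.
Qed.

End TraceSquare.

(** * Quadratic extensions *)

Section Subfield.

Variables (F : set algC) (F_field : is_subfield F).

Lemma subfield1 : F 1. Proof. by case: F_field. Qed.
Lemma subfieldB x y : F x -> F y -> F (x - y). Proof. by case: F_field => _ h _; exact: h. Qed.
Lemma subfield_div x y : F x -> F y -> F (x / y). Proof. by case: F_field => _ _; exact. Qed.
Lemma subfield0 : F 0.
Proof. by rewrite -(subrr 1); apply: subfieldB; exact: subfield1. Qed.
Lemma subfieldN x : F x -> F (- x).
Proof. by move=> Fx; rewrite -[- x]add0r; apply: subfieldB => //; exact: subfield0. Qed.
Lemma subfieldD x y : F x -> F y -> F (x + y).
Proof. by move=> Fx Fy; rewrite -[y]opprK; apply: subfieldB => //; exact: subfieldN. Qed.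
Lemma subfieldV x : F x -> F x^-1.
Proof. by move=> Fx; rewrite -div1r; apply: subfield_div => //; exact: subfield1. Qed.
Lemma subfieldM x y : F x -> F y -> F (x * y).
Proof. by move=> Fx Fy; rewrite -[y]invrK; apply: subfield_div => //; exact: subfieldV. Qed.
Lemma subfieldX x n : F x -> F (x ^+ n).
Proof.
by move=> Fx; elim: n => [|n IH]; rewrite ?expr0 ?exprS; [exact: subfield1 | exact: subfieldM].
Qed.
Lemma subfieldXz x (n : int) : F x -> F (x ^ n).
Proof.
move=> Fx; case: n => n; first by rewrite -exprnP; exact: subfieldX.
by rewrite NegzE -exprnN; apply: subfieldV; exact: subfieldX.
Qed.
Lemma subfield_nat n : F n%:R.
Proof.
by elim: n => [|n IH]; rewrite ?mulrS; [exact: subfield0 | apply: subfieldD => //;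
  exact: subfield1].
Qed.
Lemma subfield_int (n : int) : F n%:~R.
Proof.
case: n => n; first exact: subfield_nat.
by rewrite NegzE rmorphN; apply: subfieldN; exact: subfield_nat.
Qed.
Lemma subfield_Crat x : x \in Crat -> F x.
Proof.
case/CratP=> r ->; rewrite /ratr; apply: subfield_div; exact: subfield_int.
Qed.

End Subfield.

(** * Adjunction of square roots to subfields of the algebraic numbers *)

Definition Qset : set algC := [set x | x \in Crat].

Lemma Qset_subfield : is_subfield Qset.
Proof.
split; rewrite /Qset /=; first exact: rpred1.
  by move=> x y; exact: rpredB.
by move=> x y; exact: rpred_div.
Qed.

(** For a field [F] containing [r ^+ 2] this set is the field F(r). *)
Definition adj (F : set algC) (r : algC) : set algC :=
  [set z | exists a b, [/\ F a, F b & z = a + b * r]].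

Lemma adj_sub (F : set algC) r : is_subfield F -> F `<=` adj F r.
Proof.
by move=> hF x Fx; exists x, 0; rewrite mul0r addr0; split=> //; exact: subfield0.
Qed.

Lemma adj_gen (F : set algC) r : is_subfield F -> adj F r r.
Proof.
move=> hF; exists 0, 1; rewrite mul1r add0r.
by split=> //; [exact: subfield0 | exact: subfield1].
Qed.

Lemma adj_min (F S : set algC) r :
  is_subfield S -> F `<=` S -> S r -> adj F r `<=` S.
Proof.
move=> hS FS Sr _ [a [b [Fa Fb ->]]].
by apply: subfieldD => //; [exact: FS | apply: subfieldM => //; exact: FS].
Qed.

(** The inverse of [a + b * r] is the conjugate [a - b * r] divided by the norm; for [r] outside [F]
    this norm vanishes only at 0. *)
Lemma adj_subfield (F : set algC) r :
  is_subfield F -> F (r ^+ 2) -> is_subfield (adj F r).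
Proof.
move=> hF Fr2; have [Fr|nFr] := pselect (F r).
  have -> : adj F r = F.
    by apply/seteqP; split; [exact: adj_min | exact: adj_sub].
  by [].
have adjM x y : adj F r x -> adj F r y -> adj F r (x * y).
  move=> [a [b [Fa Fb ->]]] [a' [b' [Fa' Fb' ->]]].
  exists (a * a' + b * b' * r ^+ 2), (a * b' + b * a'); split; last by ring.
    by apply: subfieldD => //; apply: subfieldM => //; exact: subfieldM.
  by apply: subfieldD => //; apply: subfieldM.
have adjV x : adj F r x -> adj F r x^-1.
  move=> [a [b [Fa Fb ->]]]; pose N := a ^+ 2 - b ^+ 2 * r ^+ 2.
  have FN : F N by apply: subfieldB => //; [|apply: subfieldM => //]; exact: subfieldX.
  have [N0|N0] := eqVneq N 0.
    have b0 : b = 0.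
      apply: contra_notP nFr => /eqP b0.
      have : (a / b) ^+ 2 = r ^+ 2.
        move/eqP: N0; rewrite subr_eq0 => /eqP N0.
        by rewrite expr_div_n N0 mulrC mulKf // expf_neq0.
      move/eqP; rewrite eqf_sqr => /orP[]/eqP E.
        by rewrite -E; apply: subfield_div.
      by rewrite -[r]opprK -E; apply: subfieldN => //; apply: subfield_div.
    by rewrite b0 mul0r addr0; apply: adj_sub => //; apply: subfieldV.
  exists (a / N), (- b / N); split; [exact: subfield_div| |].
    by apply: subfield_div => //; exact: subfieldN.
  have x0 : a + b * r != 0.
    by apply: contraNneq N0 => x0; rewrite /N -exprMn subr_sqr x0 mulr0.
  apply: (mulfI x0); rewrite mulfV //.
  transitivity (N / N); first by rewrite mulfV.
  by rewrite /N; ring.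
split; first by apply: adj_sub => //; exact: subfield1.
  move=> _ _ [a [b [Fa Fb ->]]] [a' [b' [Fa' Fb' ->]]].
  by exists (a - a'), (b - b'); split; [exact: subfieldB | exact: subfieldB | ring].
by move=> x y Fx Fy; apply: adjM => //; exact: adjV.
Qed.

Lemma field_gen_subfield S : is_subfield (field_gen S).
Proof.
split=> [A [hA _]|x y Fx Fy A [hA SA]|x y Fx Fy A [hA SA]].
- exact: subfield1.
- by apply: subfieldB => //; [exact: Fx | exact: Fy].
- by apply: subfield_div => //; [exact: Fx | exact: Fy].
Qed.

Lemma field_gen_sub S : S `<=` field_gen S.
Proof. by move=> x Sx A [_]; exact. Qed.

Lemma field_gen_min S F : is_subfield F -> S `<=` F -> field_gen S `<=` F.
Proof. by move=> hF SF x; apply. Qed.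

Lemma field_gen_adj (F S : set algC) r : is_subfield F -> F (r ^+ 2) ->
  (forall K, is_subfield K -> S `<=` K <-> F `<=` K /\ K r) ->
  field_gen S = adj F r.
Proof.
move=> hF Fr2 h; apply/seteqP; split.
  apply: field_gen_min; first exact: adj_subfield.
  apply/h; first exact: adj_subfield.
  by split; [exact: adj_sub | exact: adj_gen].
have [] := h _ (field_gen_subfield S) => /(_ (@field_gen_sub S))[FS rS] _.
by apply: adj_min => //; exact: field_gen_subfield.
Qed.

Lemma sqrtn2 n : sqrtn n ^+ 2 = n%:R. Proof. exact: sqrtCK. Qed.

Lemma Qset_sub K : is_subfield K -> Qset `<=` K.
Proof. by move=> hK x; exact: subfield_Crat. Qed.

Lemma quad_fieldE n : quad_field n = adj Qset (sqrtn n).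
Proof.
apply: field_gen_adj; [exact: Qset_subfield | by rewrite sqrtn2; exact: rpred_nat |].
move=> K hK; split=> [h|[_ h] _ ->//].
by split; [exact: Qset_sub | exact: h].
Qed.

Lemma gauss_fieldE : gauss_field = adj Qset 'i.
Proof.
apply: field_gen_adj; [exact: Qset_subfield | rewrite sqrCi; exact: rpredN1 |].
move=> K hK; split=> [h|[_ h] _ ->//].
by split; [exact: Qset_sub | exact: h].
Qed.

Lemma gauss_subfield : is_subfield gauss_field.
Proof. exact: field_gen_subfield. Qed.

Lemma field_kE p1 p2 q :
  field_k p1 p2 q = adj (adj Qset 'i) (sqrtn (p1 * p2 * q)).
Proof.
rewrite -gauss_fieldE; apply: field_gen_adj; first exact: gauss_subfield.
  by rewrite sqrtn2; apply: subfield_nat; exact: gauss_subfield.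
move=> K hK; split=> [h|[h1 h2] x [->//|->]]; last by apply: h1; exact: field_gen_sub.
split; last by apply: h; left.
by apply: field_gen_min => // _ ->; apply: h; right.
Qed.

Lemma field_K3E p1 p2 q :
  field_K3 p1 p2 q = adj (field_k p1 p2 q) (sqrtn q).
Proof.
have hk : is_subfield (field_k p1 p2 q) by exact: field_gen_subfield.
apply: field_gen_adj => //; first by rewrite sqrtn2; exact: subfield_nat.
move=> K hK; split=> [h|[h1 h2] x [/h1//|->//]].
by split; [move=> x kx; apply: h; left | apply: h; right].
Qed.

Lemma adj_swap F r s : adj (adj F r) s = adj (adj F s) r.
Proof.
suff sub F' r' s' : adj (adj F' r') s' `<=` adj (adj F' s') r'.
  by apply/seteqP; split; exact: sub.
move=> _ [_ [_ [[a [b [Fa Fb ->]]] [c [d [Fc Fd ->]]] ->]]].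
exists (a + c * s'), (b + d * s'); split; last by ring.
  by exists a, c.
by exists b, d.
Qed.

(** [(r * s) * s] is [r] times the nonzero element [s ^+ 2] of [F]. With [r * s] equal to sqrt d,
    this identifies L with Q(i, sqrt m, sqrt q). *)
Lemma adj_mulr F r s : is_subfield F -> F (s ^+ 2) -> s != 0 ->
  adj (adj F (r * s)) s = adj (adj F r) s.
Proof.
move=> hF Fs2 s0; apply/seteqP; split=> _ [_ [_ [[a [b [Fa Fb ->]]] [c [d [Fc Fd ->]]] ->]]].
  exists (a + d * s ^+ 2 * r), (c + b * r); split; last by ring.
    by exists a, (d * s ^+ 2); split=> //; exact: subfieldM.
  by exists c, b.
exists (a + d * (r * s)), (c + b / s ^+ 2 * (r * s)); split; last by field.
  by exists a, d.
by exists c, (b / s ^+ 2); split=> //; apply: subfield_div.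
Qed.

(** If [nu] fixes [a + b * r], then [2 * b * r = 0], hence [b = 0]. *)
Lemma adj_fixed (nu : {rmorphism algC -> algC}) F r z :
    (forall x, F x -> nu x = x) -> nu r = - r -> r != 0 ->
  adj F r z -> nu z = z -> F z.
Proof.
move=> nuF nur r0 [a [b [Fa Fb ->]]]; rewrite rmorphD rmorphM nur !nuF //.
move/addrI; rewrite mulrN => /eqP; rewrite -subr_eq0 -opprD oppr_eq0 -mulr2n mulrn_eq0 /=.
by rewrite mulf_eq0 (negPf r0) orbF => /eqP ->; rewrite mul0r addr0.
Qed.

Lemma adj_agree (f g : {rmorphism algC -> algC}) (F : set algC) r :
    (forall x, F x -> f x = g x) -> f r = g r ->
  forall x, adj F r x -> f x = g x.
Proof. by move=> fg fgr _ [a [b [Fa Fb ->]]]; rewrite !rmorphD !rmorphM fgr !fg. Qed.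

Lemma Qset_fixed (f : {rmorphism algC -> algC}) x : Qset x -> f x = x.
Proof. by move/CratP=> [r ->]; rewrite fmorph_rat. Qed.

Lemma adj_stable (f : {rmorphism algC -> algC}) (F : set algC) r :
    (forall x, F x -> F (- x)) -> (forall x, F x -> F (f x)) ->
    f r = r \/ f r = - r ->
  forall x, adj F r x -> adj F r (f x).
Proof.
move=> FN Ff fr _ [a [b [Fa Fb ->]]]; rewrite rmorphD rmorphM.
case: fr => ->; [exists (f a), (f b)|exists (f a), (- f b)]; split; auto.
by rewrite mulrN mulNr.
Qed.

(** * Ideal classes and extension of ideals *)

Section RingOfInt.

Variables (K : set algC) (hK : is_subfield K).
Local Notation O := (ring_of_int K).

Lemma ring_of_int0 : O 0. Proof. by split; [exact: subfield0 | exact: Aint0]. Qed.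
Lemma ring_of_int1 : O 1. Proof. by split; [exact: subfield1 | exact: Aint1]. Qed.
Lemma ring_of_intB x y : O x -> O y -> O (x - y).
Proof. by move=> [Kx Ax] [Ky Ay]; split; [exact: subfieldB | exact: rpredB]. Qed.
Lemma ring_of_intD x y : O x -> O y -> O (x + y).
Proof. by move=> [Kx Ax] [Ky Ay]; split; [exact: subfieldD | exact: rpredD]. Qed.
Lemma ring_of_intM x y : O x -> O y -> O (x * y).
Proof. by move=> [Kx Ax] [Ky Ay]; split; [exact: subfieldM | exact: rpredM]. Qed.
Lemma ring_of_int_nat n : O n%:R.
Proof. by split; [exact: subfield_nat | exact: rpred_nat]. Qed.
Lemma ring_of_int_int (n : int) : O n%:~R.
Proof. by split; [exact: subfield_int | exact: rpred_int]. Qed.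

Lemma ring_of_int_submodule : int_submodule K O.
Proof.
split; last by move=> a x; exact: ring_of_intM.
by split; [exact: ring_of_int0 | exact: ring_of_intB].
Qed.

End RingOfInt.

Lemma submodule0 K I : int_submodule K I -> I 0. Proof. by case=> -[]. Qed.
Lemma submoduleB K I x y : int_submodule K I -> I x -> I y -> I (x - y).
Proof. by case=> -[_ h] _; exact: h. Qed.
Lemma submoduleN K I x : int_submodule K I -> I x -> I (- x).
Proof. by move=> hI Ix; rewrite -[- x]add0r; apply: (submoduleB hI) => //;
  exact: submodule0 hI. Qed.
Lemma submoduleD K I x y : int_submodule K I -> I x -> I y -> I (x + y).
Proof. by move=> hI Ix Iy; rewrite -[y]opprK; apply: (submoduleB hI) => //;
  exact: submoduleN hI _. Qed.
Lemma submoduleM K I a x : int_submodule K I -> ring_of_int K a -> I x -> I (a * x).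
Proof. by case=> _; exact. Qed.

Lemma scale_setP (a : algC) I x : a != 0 -> scale_set a I x <-> I (x / a).
Proof.
move=> a0; split=> [[y Iy <-]|Ix]; first by rewrite mulrC mulKf.
by exists (x / a) => //; rewrite mulrC divfK.
Qed.

Lemma scale_setM a b I : scale_set a (scale_set b I) = scale_set (a * b) I.
Proof.
apply/seteqP; split=> [_ [_ [x Ix <-] <-]|_ [x Ix <-]]; first by exists x => //; rewrite mulrA.
by exists (b * x); [exists x | rewrite mulrA].
Qed.

Lemma scale_set1 I : scale_set 1 I = I.
Proof.
by apply/seteqP; split=> [_ [x Ix <-]|x Ix]; [rewrite mul1r | exists x; rewrite ?mul1r].
Qed.

Lemma scale_submodule K I a : int_submodule K I -> int_submodule K (scale_set a I).
Proof.
move=> hI; split; first split.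
- by exists 0; [exact: submodule0 hI | rewrite mulr0].
- move=> _ _ [x Ix <-] [y Iy <-]; exists (x - y); first exact: submoduleB hI _ _.
  by rewrite mulrBr.
- move=> c _ Oc [x Ix <-]; exists (c * x); first exact: submoduleM hI _ _.
  by rewrite mulrCA.
Qed.

Lemma scale_unit K a u : is_subfield K -> ring_of_int K u -> ring_of_int K u^-1 -> u != 0 ->
  scale_set (a * u) (ring_of_int K) = scale_set a (ring_of_int K).
Proof.
move=> hK Ou Oui u0; apply/seteqP; split=> _ [x Ox <-].
  by exists (u * x); [exact: ring_of_intM | rewrite mulrA].
by exists (u^-1 * x); [exact: ring_of_intM | rewrite mulrA mulfK].
Qed.

Lemma ideal_class_refl K I : is_subfield K -> ideal_class K I I.
Proof. by move=> hK; exists 1; rewrite oner_neq0 scale_set1; split=> //; exact: subfield1. Qed.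

Lemma ideal_class_eqP K I J : is_subfield K ->
  ideal_class K I = ideal_class K J <-> exists a, [/\ K a, a != 0 & I = scale_set a J].
Proof.
move=> hK; split=> [e|[a [Ka a0 ->]]].
  by have := ideal_class_refl I hK; rewrite e.
apply/seteqP; split=> X [b [Kb b0 ->]].
  by exists (b * a); rewrite scale_setM mulf_neq0 //; split=> //; exact: subfieldM.
exists (b / a); rewrite scale_setM divfK // mulf_neq0 ?invr_eq0 //.
by split=> //; exact: subfield_div.
Qed.

Section IdealMul.

Variables (I J : set algC).

Lemma ideal_mul_subgroup : add_subgroup (ideal_mul I J).
Proof.
split=> [A [[]] //|x y Ix Iy A [hA sA]].
by case: (hA) => _; apply; [exact: Ix | exact: Iy].
Qed.

Lemma ideal_mul_mem x y : I x -> J y -> ideal_mul I J (x * y).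
Proof. by move=> Ix Jy A [_]; apply; exists x => //; exists y. Qed.

Lemma ideal_mul_min A : add_subgroup A ->
  (forall x y, I x -> J y -> A (x * y)) -> ideal_mul I J `<=` A.
Proof. by move=> hA sA z; apply; split=> // _ [x Ix [y Jy <-]]; exact: sA. Qed.

Lemma ideal_mul_submodule K : int_submodule K I -> int_submodule K (ideal_mul I J).
Proof.
move=> hI; split; first exact: ideal_mul_subgroup.
move=> a x Oa; move: x; apply: ideal_mul_min.
  case: ideal_mul_subgroup => h0 hB; split; rewrite ?mulr0 //.
  by move=> x y hx hy; rewrite mulrBr; exact: hB.
move=> x y Ix Jy; rewrite mulrA; apply: ideal_mul_mem => //.
exact: submoduleM hI _ _.
Qed.

End IdealMul.

Lemma ideal_mulC I J : ideal_mul I J = ideal_mul J I.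
Proof.
suff sub A B : ideal_mul A B `<=` ideal_mul B A by apply/seteqP; split; exact: sub.
apply: ideal_mul_min; first exact: ideal_mul_subgroup.
by move=> x y Ax By; rewrite mulrC; exact: ideal_mul_mem.
Qed.

Lemma fractional_ideal_mul K I J : is_subfield K ->
  fractional_ideal K I -> fractional_ideal K J -> fractional_ideal K (ideal_mul I J).
Proof.
move=> hK [hI IK [x Ix x0] [d [Od d0 dI]]] [hJ JK [y Jy y0] [c [Oc c0 cJ]]]; split.
- exact: ideal_mul_submodule.
- apply: ideal_mul_min.
    by split; [exact: subfield0 | move=> *; exact: subfieldB].
  by move=> z t /IK Kz /JK Kt; exact: subfieldM.
- by exists (x * y); [exact: ideal_mul_mem | rewrite mulf_neq0].
- exists (d * c); rewrite mulf_neq0 //; split=> //; first exact: ring_of_intM.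
  apply: ideal_mul_min.
    split; first by rewrite mulr0; exact: ring_of_int0.
    by move=> z t hz ht; rewrite mulrBr; exact: ring_of_intB.
  by move=> z t Iz Jt; rewrite mulrACA; apply: ring_of_intM => //; [exact: dI | exact: cJ].
Qed.

Section IdealExt.

Variables (L I : set algC).

Lemma ideal_ext_submodule : int_submodule L (ideal_ext L I).
Proof.
split; first split.
- by move=> A [hA _]; exact: submodule0 hA.
- by move=> x y hx hy A hA; apply: (submoduleB hA.1); [exact: hx | exact: hy].
- by move=> a x Oa hx A hA; apply: (submoduleM hA.1) => //; exact: hx.
Qed.

Lemma ideal_ext_sub : I `<=` ideal_ext L I.
Proof. by move=> x Ix A [_]; exact. Qed.

Lemma ideal_ext_min A : int_submodule L A -> I `<=` A -> ideal_ext L I `<=` A.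
Proof. by move=> hA IA x; apply. Qed.

End IdealExt.

Lemma ideal_ext_scale L I b : b != 0 ->
  ideal_ext L (scale_set b I) = scale_set b (ideal_ext L I).
Proof.
move=> b0; apply/seteqP; split.
  apply: ideal_ext_min; first by apply: scale_submodule; exact: ideal_ext_submodule.
  by move=> _ [x Ix <-]; exists x => //; exact: ideal_ext_sub.
move=> _ [x Ix <-]; suff : scale_set b^-1 (ideal_ext L (scale_set b I)) x.
  by rewrite scale_setP ?invr_eq0 // invrK mulrC.
apply: (ideal_ext_min _ _ Ix).
  by apply: scale_submodule; exact: ideal_ext_submodule.
move=> y Iy; apply/scale_setP; rewrite ?invr_eq0 // invrK mulrC.
by apply: ideal_ext_sub; exists y.
Qed.

Definition ext_gen L I a := ideal_ext L I = scale_set a (ring_of_int L).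

Section ExtGen.

Variables (L : set algC) (hL : is_subfield L).
Local Notation O := (ring_of_int L).

Lemma ext_gen_mem I a : ext_gen L I a -> ideal_ext L I a.
Proof. by move->; exists 1; rewrite ?mulr1 //; exact: ring_of_int1. Qed.

Lemma ext_gen_intro I a : I `<=` scale_set a O -> ideal_ext L I a -> ext_gen L I a.
Proof.
move=> Ia aI; apply/seteqP; split.
  by apply: ideal_ext_min => //; apply: scale_submodule; exact: ring_of_int_submodule.
move=> _ [x Ox <-]; rewrite mulrC.
exact: submoduleM (ideal_ext_submodule L I) Ox aI.
Qed.

Lemma ext_gen_scale I a b : b != 0 -> ext_gen L I a -> ext_gen L (scale_set b I) (b * a).
Proof. by move=> b0 e; rewrite /ext_gen ideal_ext_scale // e scale_setM. Qed.

Lemma ext_gen_unit I a u : O u -> O u^-1 -> u != 0 ->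
  ext_gen L I a -> ext_gen L I (a * u).
Proof. by move=> Ou Oui u0 e; rewrite /ext_gen scale_unit. Qed.

Lemma ext_gen_mul I J a b :
  ext_gen L I a -> ext_gen L J b -> ext_gen L (ideal_mul I J) (a * b).
Proof.
move=> eI eJ; apply: ext_gen_intro.
  apply: ideal_mul_min.
    by case: (scale_submodule (a * b) (ring_of_int_submodule hL)).
  move=> x y /(@ideal_ext_sub L); rewrite eI => -[x' Ox' <-].
  move=> /(@ideal_ext_sub L); rewrite eJ => -[y' Oy' <-].
  by exists (x' * y'); [exact: ring_of_intM | ring].
have hE := ideal_ext_submodule L (ideal_mul I J).
(* The [z] with [z * b] in the extended ideal form a module over [O], so only [z] in [I] matters;
   the same reduction is then applied to the other factor. *)
suff sub : ideal_ext L I `<=` [set z | ideal_ext L (ideal_mul I J) (z * b)].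
  by apply: sub; exact: ext_gen_mem.
apply: ideal_ext_min => [|x Ix /=].
  split; first split=> /=; first by rewrite mul0r; exact: submodule0 hE.
    by move=> x y hx hy; rewrite mulrBl; exact: submoduleB hE _ _.
  by move=> c x Oc hx; rewrite /= -mulrA; exact: submoduleM hE _ _.
suff sub : ideal_ext L J `<=` [set z | ideal_ext L (ideal_mul I J) (x * z)].
  by apply: sub; exact: ext_gen_mem.
apply: ideal_ext_min => [|y Jy /=]; last by apply: ideal_ext_sub; exact: ideal_mul_mem.
split; first split=> /=; first by rewrite mulr0; exact: submodule0 hE.
  by move=> y z hy hz; rewrite mulrBr; exact: submoduleB hE _ _.
by move=> c y Oc hy; rewrite /= mulrCA; exact: submoduleM hE _ _.
Qed.

(** Multiplication by [a] sends [J] into [c * O], because [a] lies in the extension of [I].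
    Conversely every [x] in [I] is some [a * r], so [x * y / a = r * y] stays in the extension of
    [J]. *)
Lemma ext_gen_cancel I J a c : a != 0 ->
  ext_gen L I a -> ext_gen L (ideal_mul I J) c -> ext_gen L J (c / a).
Proof.
move=> a0 eI eIJ; have hE := ideal_ext_submodule L J; apply: ext_gen_intro.
  move=> y Jy; suff sub : ideal_ext L I `<=` [set z | scale_set c O (z * y)].
    have [r Or rE] := sub _ (ext_gen_mem eI); exists r => //.
    by apply: (mulfI a0); rewrite -rE; field.
  have hO := scale_submodule c (ring_of_int_submodule hL).
  apply: ideal_ext_min => [|x Ix /=].
    split; first split=> /=; first by rewrite mul0r; exact: submodule0 hO.
      by move=> x z hx hz; rewrite mulrBl; exact: submoduleB hO _ _.
    by move=> b x Ob hx; rewrite /= -mulrA; exact: submoduleM hO _ _.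
  by rewrite -eIJ; apply: ideal_ext_sub; exact: ideal_mul_mem.
suff sub : ideal_ext L (ideal_mul I J) `<=` [set z | ideal_ext L J (z / a)].
  by apply: sub; exact: ext_gen_mem.
apply: ideal_ext_min => [|z].
  split; first split=> /=; first by rewrite mul0r; exact: submodule0 hE.
    by move=> x y hx hy; rewrite mulrBl; exact: submoduleB hE _ _.
  by move=> b x Ob hx; rewrite /= -mulrA; exact: submoduleM hE _ _.
move: z; apply: ideal_mul_min.
  split=> /=; first by rewrite mul0r; exact: submodule0 hE.
  by move=> x y hx hy; rewrite mulrBl; exact: submoduleB hE _ _.
move=> x y /(@ideal_ext_sub L); rewrite eI => -[r Or <-] Jy /=.
have -> : a * r * y / a = r * y by field.
by apply: (submoduleM hE) => //; exact: ideal_ext_sub.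
Qed.

End ExtGen.

(** * Ideals of K that become principal in L *)

Section Capitulation.

Variables (K L : set algC) (hK : is_subfield K) (hL : is_subfield L) (KL : K `<=` L).

Lemma ring_of_int_sub : ring_of_int K `<=` ring_of_int L.
Proof. by move=> x [/KL]. Qed.

Lemma ext_gen_ring : ext_gen L (ring_of_int K) 1.
Proof.
apply: ext_gen_intro => //; first by rewrite scale_set1; exact: ring_of_int_sub.
by apply: ideal_ext_sub; exact: ring_of_int1.
Qed.

Lemma ext_gen_principal a : a != 0 -> ext_gen L (scale_set a (ring_of_int K)) a.
Proof. by move=> a0; rewrite -[X in ext_gen _ _ X]mulr1; apply: ext_gen_scale => //;
  exact: ext_gen_ring. Qed.

Lemma fractional_ring_of_int : fractional_ideal K (ring_of_int K).
Proof.
split; [exact: ring_of_int_submodule | by move=> x [] | |].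
  by exists 1; [exact: ring_of_int1 | exact: oner_neq0].
exists 1; rewrite oner_neq0; split=> //; first exact: ring_of_int1.
by move=> x Ox; rewrite mul1r.
Qed.

(** Capitulation does not depend on the representative: if [J = b I] becomes [(a)], then [I] becomes
    [(a / b)]. *)
Lemma capitulationP I : fractional_ideal K I ->
  capitulation_kernel K L (ideal_class K I) <-> exists a, [/\ L a, a != 0 & ext_gen L I a].
Proof.
move=> fI; split=> [[J [fJ /(ideal_class_eqP _ _ hL)[a [La a0 eJ]]]]|[a [La a0 eI]]].
  move=> /(ideal_class_eqP _ _ hK)[b [Kb b0 JE]]; exists (a / b); split.
  - by apply: subfield_div => //; exact: KL.
  - by rewrite mulf_neq0 ?invr_eq0.
  - have -> : I = scale_set b^-1 J by rewrite JE scale_setM mulVf // scale_set1.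
    by rewrite mulrC; apply: ext_gen_scale; rewrite ?invr_eq0.
exists I => //; split=> //; apply/(ideal_class_eqP _ _ hL).
by exists a.
Qed.

Lemma capitulation_subgroup : class_subgroup K (capitulation_kernel K L).
Proof.
split.
- by move=> _ [I [fI _] <-]; exists I.
- apply/capitulationP; first exact: fractional_ring_of_int.
  exists 1; rewrite oner_neq0; split=> //; first exact: subfield1.
  exact: ext_gen_ring.
- move=> I J fI fJ /(capitulationP fI)[a [La a0 eI]] /(capitulationP fJ)[b [Lb b0 eJ]].
  apply/capitulationP; first exact: fractional_ideal_mul.
  exists (a * b); rewrite mulf_neq0 //; split=> //; first exact: subfieldM.
  exact: ext_gen_mul.
- move=> I J fI fJ /(ideal_class_eqP _ _ hK)[c [Kc c0 IJ]] /(capitulationP fI)[a [La a0 eI]].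
  apply/(capitulationP fJ); exists (c / a).
  rewrite mulf_neq0 ?invr_eq0 //; split=> //; first by apply: subfield_div => //; exact: KL.
  apply: (ext_gen_cancel hL a0 eI); rewrite IJ.
  exact: ext_gen_principal.
Qed.

(** * Recovery of an ideal of K from its extension, by the relative trace *)

Variables (s : {rmorphism algC -> algC}) (w : algC).
Hypotheses (sK : forall x, K x -> s x = x) (sfix : forall x, L x -> s x = x -> K x).
Hypotheses (sL : forall x, L x -> L (s x)) (s_inv : forall x, L x -> s (s x) = x).
Hypotheses (Ow : ring_of_int L w) (trw : w + s w = 1).

Lemma trace_ring_of_int x : ring_of_int L x -> ring_of_int K (x + s x).
Proof.
move=> [Lx Ax]; split; last by rewrite rpredD // Aint_aut.
apply: sfix; first by apply: subfieldD => //; exact: sL.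
by rewrite rmorphD s_inv // addrC.
Qed.

(* Since [w] has trace one, [y = Tr (w * y)] for [y] in [K], and the trace of
   an element of the extended ideal lies in the ideal. *)
Lemma ideal_ext_contract I y : int_submodule K I -> I `<=` K ->
  ideal_ext L I y -> K y -> I y.
Proof.
move=> hI IK Iy Ky.
suff sub : ideal_ext L I `<=`
    [set z | forall c, ring_of_int L c -> I (w * (c * z) + s (w * (c * z)))].
  have := sub _ Iy _ (ring_of_int1 hL).
  by rewrite mul1r rmorphM (sK Ky) -mulrDl trw mul1r.
apply: ideal_ext_min => [|x Ix /= c Oc].
  split; first split=> /=.
  - by move=> c Oc; rewrite !mulr0 rmorph0 addr0; exact: submodule0 hI.
  - move=> x z hx hz c Oc; rewrite mulrBr mulrBr rmorphB addrACA -opprD.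
    by apply: (submoduleB hI); [exact: hx | exact: hz].
  - by move=> a x Oa hx c Oc /=; rewrite [c * _]mulrA; apply: hx; exact: ring_of_intM.
have -> : w * (c * x) + s (w * (c * x)) = (w * c + s (w * c)) * x.
  by rewrite mulrA rmorphM (sK (IK _ Ix)) mulrDl.
apply: (submoduleM hI) => //; apply: trace_ring_of_int; exact: ring_of_intM.
Qed.

Lemma ext_gen_inj I J a : int_submodule K I -> I `<=` K ->
  int_submodule K J -> J `<=` K -> ext_gen L I a -> ext_gen L J a -> I = J.
Proof.
move=> hI IK hJ JK eI eJ; apply/seteqP; split=> x h.
  by apply: ideal_ext_contract (IK _ h) => //; rewrite eJ -eI; exact: ideal_ext_sub.
by apply: ideal_ext_contract (JK _ h) => //; rewrite eI -eJ; exact: ideal_ext_sub.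
Qed.

(** [b I] and [J] have the same extension, their generators differing by the unit [u], and an ideal
    is determined by its extension. *)
Lemma ext_gen_class I J a b u : fractional_ideal K I -> fractional_ideal K J ->
    ext_gen L I a -> ext_gen L J (b * a * u) -> K b -> b != 0 ->
    ring_of_int L u -> ring_of_int L u^-1 -> u != 0 ->
  ideal_class K J = ideal_class K I.
Proof.
move=> [hI IK _ _] [hJ JK _ _] eI eJ Kb b0 Ou Oui u0; apply/ideal_class_eqP => //.
exists b; split=> //; apply: (@ext_gen_inj _ _ (b * a * u)) => //.
- exact: scale_submodule.
- by move=> _ [x Ix <-]; apply: subfieldM => //; exact: IK.
- by apply: ext_gen_unit => //; exact: ext_gen_scale.
Qed.

End Capitulation.

(** * Galois action on L *)

Lemma sqrtn_ge0 n : 0 <= sqrtn n. Proof. by rewrite sqrtC_ge0 ler0n. Qed.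
Lemma sqrtn_neq0 n : (0 < n)%N -> sqrtn n != 0.
Proof. by move=> n0; rewrite sqrtC_eq0 pnatr_eq0 -lt0n. Qed.
Lemma conj_sqrtn n : (sqrtn n)^* = sqrtn n.
Proof. by apply: CrealP; exact: ger0_real (sqrtn_ge0 n). Qed.
Lemma sqrtnM a b : sqrtn (a * b) = sqrtn a * sqrtn b.
Proof. by rewrite /sqrtn natrM sqrtCM // nnegrE ler0n. Qed.
Lemma sqrtn_irrational n p : odd (logn p n) -> sqrtn n \notin Crat.
Proof.
move=> on; apply/negP => nQ; move/negP: (Crat_sqr_logn p nQ (sqrtn2 n)); exact.
Qed.
Lemma sqrtn_Aint n : sqrtn n \in Aint.
Proof. by apply: Aint_sqr; rewrite sqrtn2 rpred_nat. Qed.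
Lemma Ci_Aint : 'i \in Aint.
Proof. by apply: Aint_sqr; rewrite sqrCi rpredN1. Qed.

(* The data attached to L = Q(i, sqrt m, sqrt q), where m = p1 p2, with the
   generator [s] of Gal(L/k) and the generator [t] of Gal(L/Q(i, sqrt m)). *)
Record K3_setting (p1 p2 q : nat) (s t : {rmorphism algC -> algC}) : Prop := K3Setting {
  K3_p1 : prime p1; K3_p2 : prime p2; K3_q : prime q;
  K3_p12 : p1 <> p2; K3_p1q : p1 <> q; K3_p2q : p2 <> q;
  K3_p1_mod : (p1 %% 4 = 1)%N; K3_p2_mod : (p2 %% 4 = 1)%N; K3_q_mod : (q %% 4 = 3)%N;
  K3_si : s 'i = 'i; K3_sq : s (sqrtn q) = - sqrtn q;
  K3_sm : s (sqrtn (p1 * p2)) = - sqrtn (p1 * p2);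
  K3_ti : t 'i = 'i; K3_tq : t (sqrtn q) = - sqrtn q;
  K3_tm : t (sqrtn (p1 * p2)) = sqrtn (p1 * p2) }.

(** The radicands [q], [m] and [m q] have odd valuation at [q], [p1] and [q] respectively, so the
    three square roots are irrational. *)
Lemma K3_setting_exists p1 p2 q : prime p1 -> prime p2 -> prime q ->
    p1 <> p2 -> p1 <> q -> p2 <> q ->
    (p1 %% 4 = 1)%N -> (p2 %% 4 = 1)%N -> (q %% 4 = 3)%N ->
  exists s t, K3_setting p1 p2 q s t.
Proof.
move=> pp1 pp2 pq p12 p1q p2q p1_mod p2_mod q_mod.
have rat2 n : sqrtn n ^+ 2 \in Crat by rewrite sqrtn2 rpred_nat.
have l1 : logn p1 (p1 * p2) = 1%N.
  by rewrite lognM ?prime_gt0 // !logn_prime // eqxx; case: eqP.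
have [|||||||s [t [[s1 s2 s3] [t1 t2 t3]]]] :=
    @biquadratic_auts (sqrtn q) (sqrtn (p1 * p2)).
- exact: rat2.
- exact: rat2.
- exact: conj_sqrtn.
- exact: conj_sqrtn.
- by apply: (@sqrtn_irrational _ q); rewrite logn_prime // eqxx.
- by apply: (@sqrtn_irrational _ p1); rewrite l1.
- rewrite -sqrtnM; apply: (@sqrtn_irrational _ q).
  rewrite lognM ?muln_gt0 ?prime_gt0 // lognM ?prime_gt0 // !logn_prime // eqxx.
  by case: eqP => [/esym//|_]; case: eqP => [/esym//|_].
by exists s, t; split.
Qed.

Section K3.

Variables (p1 p2 q : nat) (s t : {rmorphism algC -> algC}).
Hypothesis hyp : K3_setting p1 p2 q s t.

Local Notation m := (p1 * p2)%N.
Local Notation k := (field_k p1 p2 q).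
Local Notation L := (field_K3 p1 p2 q).
Local Notation sm := (sqrtn (p1 * p2)).
Local Notation sq := (sqrtn q).
Local Notation sd := (sqrtn (p1 * p2 * q)).
Local Notation conjR := (Num.conj : {rmorphism algC -> algC}).

Let pp1 := K3_p1 hyp.
Let pp2 := K3_p2 hyp.
Let pq := K3_q hyp.

Lemma K3_k_subfield : is_subfield k. Proof. exact: field_gen_subfield. Qed.
Lemma K3_L_subfield : is_subfield L. Proof. exact: field_gen_subfield. Qed.
Let hk := K3_k_subfield.
Let hL := K3_L_subfield.

Lemma K3_kL : k `<=` L.
Proof. by rewrite field_K3E; exact: adj_sub. Qed.

Lemma K3_sqrtd : sd = sm * sq. Proof. exact: sqrtnM. Qed.

Lemma K3_sq0 : sq != 0. Proof. by rewrite sqrtn_neq0 ?prime_gt0. Qed.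
Lemma K3_sm0 : sm != 0. Proof. by rewrite sqrtn_neq0 ?muln_gt0 ?prime_gt0. Qed.

Lemma Qi_subfield : is_subfield (adj Qset 'i).
Proof. by rewrite -gauss_fieldE; exact: gauss_subfield. Qed.

Lemma K3_LE : L = adj (adj (adj Qset 'i) sm) sq.
Proof.
rewrite field_K3E field_kE K3_sqrtd adj_mulr // ?K3_sq0 //; first exact: Qi_subfield.
by rewrite sqrtn2; apply: subfield_nat; exact: Qi_subfield.
Qed.

Lemma K3_ki : k 'i. Proof. by apply: field_gen_sub; right. Qed.
Lemma K3_kd : k sd. Proof. by apply: field_gen_sub; left. Qed.
Lemma K3_Li : L 'i. Proof. by apply: K3_kL; exact: K3_ki. Qed.
Lemma K3_Lq : L sq. Proof. by apply: field_gen_sub; right. Qed.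
Lemma K3_Lm : L sm.
Proof.
have -> : sm = sd / sq by rewrite K3_sqrtd mulfK // K3_sq0.
by apply: (subfield_div hL); [apply: K3_kL; exact: K3_kd | exact: K3_Lq].
Qed.

Lemma K3_agree (f g : {rmorphism algC -> algC}) : f 'i = g 'i -> f sm = g sm ->
  f sq = g sq -> forall x, L x -> f x = g x.
Proof.
move=> fi fm fq; rewrite K3_LE; do 3! [apply: adj_agree => //].
by move=> x Qx; rewrite !Qset_fixed.
Qed.

Lemma K3_stable (f : {rmorphism algC -> algC}) x : L x -> L (f x).
Proof.
have sg n : f (sqrtn n) = sqrtn n \/ f (sqrtn n) = - sqrtn n.
  by apply: rmorph_sqr_sign; rewrite sqrtn2 rpred_nat.
have nQ y : Qset y -> Qset (- y) by move=> h; rewrite /Qset /= rpredN.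
have adjN F r y : (forall z, F z -> F (- z)) -> adj F r y -> adj F r (- y).
  move=> FN [a [b [Fa Fb ->]]]; exists (- a), (- b).
  by split; [exact: FN | exact: FN | ring].
rewrite K3_LE; apply: adj_stable => //.
- by move=> y; apply: (adjN) => z; apply: (adjN) => v; exact: nQ.
- apply: adj_stable => //.
    by move=> y; apply: adjN => z; exact: nQ.
  apply: adj_stable => //; first by move=> y Qy; rewrite Qset_fixed.
  by apply: rmorph_sqr_sign; rewrite sqrCi rpredN1.
Qed.

(** Automorphisms act on ['i], sqrt m and sqrt q by signs, so Gal(L/Q) is abelian; in particular
    complex conjugation commutes with [s] and [t] on L. *)
Lemma K3_comm (f g : {rmorphism algC -> algC}) x : L x -> f (g x) = g (f x).
Proof.
move=> Lx; apply: (K3_agree (f := (f \o g)%FUN) (g := (g \o f)%FUN)) Lx => /=;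
  have sg (h : {rmorphism algC -> algC}) n : h (sqrtn n) = sqrtn n \/ h (sqrtn n) = - sqrtn n
    by apply: rmorph_sqr_sign; rewrite sqrtn2 rpred_nat.
- have si (h : {rmorphism algC -> algC}) : h 'i = 'i \/ h 'i = - 'i.
    by apply: rmorph_sqr_sign; rewrite sqrCi rpredN1.
  by case: (si f) => ef; case: (si g) => eg; rewrite ef eg ?rmorphN ?ef ?eg.
- by case: (sg f m) => ef; case: (sg g m) => eg; rewrite ef eg ?rmorphN ?ef ?eg.
- by case: (sg f q) => ef; case: (sg g q) => eg; rewrite ef eg ?rmorphN ?ef ?eg.
Qed.

Lemma K3_invol (f : {rmorphism algC -> algC}) x : L x -> f (f x) = x.
Proof.
move=> Lx; apply: (K3_agree (f := (f \o f)%FUN) (g := idfun)) Lx => /=.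
- have [ef|ef] : f 'i = 'i \/ f 'i = - 'i
    by apply: rmorph_sqr_sign; rewrite sqrCi rpredN1.
    by rewrite !ef.
  by rewrite ef rmorphN ef opprK.
- have [ef|ef] : f sm = sm \/ f sm = - sm
    by apply: rmorph_sqr_sign; rewrite sqrtn2 rpred_nat.
    by rewrite !ef.
  by rewrite ef rmorphN ef opprK.
- have [ef|ef] : f sq = sq \/ f sq = - sq
    by apply: rmorph_sqr_sign; rewrite sqrtn2 rpred_nat.
    by rewrite !ef.
  by rewrite ef rmorphN ef opprK.
Qed.

Lemma K3_sd_fixed : s sd = sd.
Proof. by rewrite K3_sqrtd rmorphM (K3_sq hyp) (K3_sm hyp) mulrNN. Qed.

Lemma K3_td : t sd = - sd.
Proof. by rewrite K3_sqrtd rmorphM (K3_tq hyp) (K3_tm hyp) mulrN. Qed.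

Lemma K3_s_id x : k x -> s x = x.
Proof.
rewrite field_kE; apply: (adj_agree (g := idfun)) => /=; last exact: K3_sd_fixed.
by apply: (adj_agree (g := idfun)) => [y|] /=; [exact: Qset_fixed | exact: K3_si hyp].
Qed.

Lemma K3_s_fixed x : L x -> s x = x -> k x.
Proof.
rewrite field_K3E; apply: adj_fixed (K3_sq hyp) K3_sq0; exact: K3_s_id.
Qed.

Lemma K3_Qi_id (f : {rmorphism algC -> algC}) x : f 'i = 'i -> adj Qset 'i x -> f x = x.
Proof. by move=> fi; apply: (adj_agree (g := idfun)) => //= y; exact: Qset_fixed. Qed.

Lemma K3_t_fixed x : L x -> t x = x -> adj (adj Qset 'i) sm x.
Proof.
rewrite K3_LE; apply: adj_fixed (K3_tq hyp) K3_sq0.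
apply: (adj_agree (g := idfun)) => /=; last exact: K3_tm hyp.
by move=> y; apply: K3_Qi_id; exact: K3_ti hyp.
Qed.

(** With the two adjunctions swapped, complex conjugation fixes Q(sqrt n) and negates ['i]. *)
Lemma K3_conj_fixed n x : adj (adj Qset 'i) (sqrtn n) x -> x^* = x ->
  adj Qset (sqrtn n) x.
Proof.
rewrite adj_swap; apply: (@adj_fixed conjR) => /=.
- by apply: (adj_agree (f := conjR) (g := idfun)) => /= [y|]; [exact: (Qset_fixed conjR) |
  exact: conj_sqrtn].
- exact: conjCi.
- exact: neq0Ci.
Qed.

Lemma K3_tc_fixed x : L x -> t x = x -> x^* = x -> adj Qset sm x.
Proof. by move=> Lx tx cx; apply: K3_conj_fixed => //; exact: K3_t_fixed. Qed.

(** [s \o t] fixes ['i] and sqrt q and negates sqrt m, so its fixed field in L is Q(i, sqrt q). *)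
Lemma K3_stc_fixed x : L x -> s (t x) = x -> x^* = x -> adj Qset sq x.
Proof.
move=> Lx stx cx; apply: K3_conj_fixed => //; move: Lx stx.
rewrite K3_LE adj_swap; apply: (@adj_fixed (s \o t)%FUN) => /=; last exact: K3_sm0.
  apply: (adj_agree (f := (s \o t)%FUN) (g := idfun)) => /= [y Qy|].
    by rewrite (K3_Qi_id (K3_ti hyp) Qy) (K3_Qi_id (K3_si hyp) Qy).
  by rewrite (K3_tq hyp) rmorphN (K3_sq hyp) opprK.
by rewrite (K3_tm hyp) (K3_sm hyp).
Qed.

Lemma K3_rational x : L x -> s x = x -> t x = x -> x^* = x -> x \in Crat.
Proof.
move=> Lx sx tx cx; have := K3_tc_fixed Lx tx cx.
by move=> h; apply: (adj_fixed _ (K3_sm hyp) K3_sm0 h sx) => y; exact: Qset_fixed.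
Qed.

Lemma K3_sub_quad n : L (sqrtn n) -> adj Qset (sqrtn n) `<=` L.
Proof. by move=> Ln; apply: adj_min => //; exact: Qset_sub. Qed.

End K3.

(** * Units of norm one in real quadratic fields *)

Section QuadTrace.

Variables (D : nat) (f : {rmorphism algC -> algC}) (v : algC).
Hypotheses (fD : f (sqrtn D) = - sqrtn D) (Qv : adj Qset (sqrtn D) v).

Lemma quad_trace_rat : v + f v \in Crat /\
  exists2 b, b \in Crat & v - f v = b * sqrtn D.
Proof.
case: Qv => a [b [Qa Qb ->]].
rewrite rmorphD rmorphM fD !Qset_fixed //; split.
  have -> : a + b * sqrtn D + (a + b * - sqrtn D) = a + a by ring.
  exact: rpredD.
by exists (b + b); [exact: rpredD | ring].
Qed.

Hypotheses (v0 : 0 < v) (Av : v \in Aint) (fv : f v = v^-1).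

(* The identity [v * (2 + v + v^-1) = (1 + v)^2] makes a unit of norm one
   equal to a positive integer up to squares. *)
Lemma unit_trace : exists n : nat, exists b : algC,
  [/\ (0 < n)%N, b \in Crat, n%:R * (n%:R - 4) = D%:R * b ^+ 2
    & v * n%:R = (1 + v) ^+ 2].
Proof.
have [trQ [b Qb Db]] := quad_trace_rat; rewrite fv in trQ Db.
have vn0 : v != 0 by rewrite gt_eqF.
have tri : v + v^-1 \in Num.int.
  by apply: Cint_rat_Aint trQ _; rewrite rpredD // -fv Aint_aut.
have tr0 : 0 < v + v^-1 by rewrite addr_gt0 ?invr_gt0.
have /natrP[N NE] : 2 + (v + v^-1) \in Num.nat.
  by rewrite natrEint rpredD ?rpred_nat //= addr_ge0 ?ltW.
(* As [n] is [2 + v + v^-1], the product [n (n - 4)] is the square of [v - v^-1], a rational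
   multiple of sqrt D. *)
exists N, b; rewrite -NE; split=> //.
- by rewrite -(ltr_nat algC) -NE addr_gt0.
- by rewrite -(sqrtn2 D) -exprMn [sqrtn D * b]mulrC -Db; field.
- by field.
Qed.

End QuadTrace.

(** Modulo 4 the equation forces [a] and [b] to be even; after division by 4 it reads
    [q a^2 = b^2 + 1], which fails modulo 4. *)
Lemma norm_neg1_nat (q a b : nat) : (q %% 4 = 3)%N -> (q * a ^ 2 = b ^ 2 + 4)%N -> False.
Proof.
move=> q4; have -> : q = (4 * (q %/ 4) + 3)%N by lia.
move: (q %/ 4)%N => j; rewrite -[a]odd_double_half -[b]odd_double_half.
move: (odd a) (odd b) (a./2) (b./2) => e f {}a {}b; rewrite -!muln2.
case: e; case: f => E; try lia.
have {E} : ((4 * j + 3) * a ^ 2 = b ^ 2 + 1)%N by nia.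
rewrite -[a]odd_double_half -[b]odd_double_half.
move: (odd a) (odd b) (a./2) (b./2) => e f {}a {}b; rewrite -!muln2.
by case: e; case: f => E; lia.
Qed.

(** With norm -1, the trace [S] and [T = (w - f w) / sqrt q] are integers satisfying
    [q T^2 = S^2 + 4], which [norm_neg1_nat] excludes. *)
Lemma quad_norm_neg1 (q : nat) (f : {rmorphism algC -> algC}) (w : algC) :
    prime q -> (q %% 4 = 3)%N -> f (sqrtn q) = - sqrtn q -> adj Qset (sqrtn q) w ->
  w \in Aint -> w * f w <> -1.
Proof.
move=> pq q4 fq Qw Aw N1; have [trQ [b Qb Db]] := quad_trace_rat fq Qw.
have /intrP[S SE] : w + f w \in Num.int by rewrite Cint_rat_Aint // rpredD ?Aint_aut.
have E : q%:R * b ^+ 2 = (S ^+ 2 + 4)%:~R :> algC.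
  rewrite -(sqrtn2 q) -exprMn [sqrtn q * b]mulrC -Db rmorphD rmorphXn /= -SE.
  by have -> : 4%:~R = - (4 * (w * f w)) :> algC; [rewrite N1; ring | ring].
have /intrP[T TE] : b \in Num.int.
  apply: (@radical_int q) => //; [exact: prime_gt0 | exact: radical_prime |].
  by rewrite E intr_int.
have {}E : (q * `|T| ^ 2 = `|S| ^ 2 + 4)%N.
  apply/eqP; rewrite -(eqr_nat algC) natrM natrD !natr_sqr_absz -TE E.
  by rewrite rmorphD rmorphXn.
exact: norm_neg1_nat E.
Qed.

(** * Rational squares in L *)

Section K3Squares.

Variables (p1 p2 q : nat) (s t : {rmorphism algC -> algC}).
Hypothesis hyp : K3_setting p1 p2 q s t.

Local Notation m := (p1 * p2)%N.
Local Notation L := (field_K3 p1 p2 q).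
Local Notation sm := (sqrtn (p1 * p2)).
Local Notation sq := (sqrtn q).
Local Notation conjR := (Num.conj : {rmorphism algC -> algC}).

Let pp1 := K3_p1 hyp.
Let pp2 := K3_p2 hyp.
Let pq := K3_q hyp.
Let hk := K3_k_subfield p1 p2 q.
Let hL := K3_L_subfield p1 p2 q.

(** Kummer theory for L: automorphisms change [z] by signs, and multiplying by generators with the
    same signs gives a rational number. *)
Lemma K3_sqr_rat z : L z -> z ^+ 2 \in Crat ->
  exists e f g : bool, z * ('i ^+ e * sm ^+ f * sq ^+ g) \in Crat.
Proof.
move=> Lz z2; have sg (h : {rmorphism algC -> algC}) := rmorph_sqr_sign h z2.
suff [e [f [g [hs ht hc]]]] : exists e f g : bool,
    [/\ s z = (-1) ^+ (f + g) * z, t z = (-1) ^+ g * z & z^* = (-1) ^+ e * z].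
  have Lw : L (z * ('i ^+ e * sm ^+ f * sq ^+ g)).
    apply: (subfieldM hL) => //; apply: (subfieldM hL); first apply: (subfieldM hL);
      apply: (subfieldX hL); [exact: K3_Li | exact: K3_Lm hyp | exact: K3_Lq].
  exists e, f, g; apply: (K3_rational hyp Lw); rewrite !rmorphM !rmorphXn.
  - rewrite (K3_si hyp) (K3_sm hyp) (K3_sq hyp) hs.
    by case: f {hs Lw} => //; case: g {ht} => //; rewrite ?expr0 ?expr1; ring.
  - rewrite (K3_ti hyp) (K3_tm hyp) (K3_tq hyp) ht.
    by case: g {hs Lw ht}; rewrite ?expr0 ?expr1; ring.
  - rewrite /= conjCi !conj_sqrtn hc.
    by case: e {hc Lw}; rewrite ?expr0 ?expr1; ring.
have [e he] : exists e : bool, z^* = (-1) ^+ e * z.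
  by case: (sg conjR) => /= ->; [exists false | exists true]; rewrite ?mul1r ?mulN1r.
have [g hg] : exists g : bool, t z = (-1) ^+ g * z.
  by case: (sg t) => ->; [exists false | exists true]; rewrite ?mul1r ?mulN1r.
have [f hf] : exists f : bool, s z = (-1) ^+ f * z.
  by case: (sg s) => ->; [exists false | exists true]; rewrite ?mul1r ?mulN1r.
(* [s] negates both sqrt m and sqrt q while [t] negates only sqrt q; hence the exponent [f (+) g] of
   sqrt m. *)
exists e, (f (+) g), g; split=> //; rewrite hf; congr (_ * _).
by rewrite -[RHS]signr_odd oddD !oddb -addbA addbb addbF.
Qed.

(** Up to sign [n * m ^ f * q ^ g] is the square of a rational number, and squares of rational
    numbers are nonnegative. *)
Lemma K3_sqr_parity z n : L z -> (0 < n)%N -> z ^+ 2 = n%:R \/ z ^+ 2 = - n%:R ->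
  exists f g : bool, forall p, ~~ odd (logn p (n * (m ^ f * q ^ g))).
Proof.
move=> Lz n0 z2; have z2Q : z ^+ 2 \in Crat by case: z2 => ->; rewrite ?rpredN rpred_nat.
have [e [f [g wQ]]] := K3_sqr_rat Lz z2Q; exists f, g => p.
apply: (Crat_sqr_logn _ wQ).
set N := (n * _)%N; have N0 : (0 < N)%N by rewrite !muln_gt0 !expn_gt0 !muln_gt0 n0 !prime_gt0.
have w2 : 0 <= (z * ('i ^+ e * sm ^+ f * sq ^+ g)) ^+ 2.
  by rewrite real_exprn_even_ge0 // Creal_Crat.
have : (z * ('i ^+ e * sm ^+ f * sq ^+ g)) ^+ 2 = N%:R \/
       (z * ('i ^+ e * sm ^+ f * sq ^+ g)) ^+ 2 = - N%:R.
  have -> : (z * ('i ^+ e * sm ^+ f * sq ^+ g)) ^+ 2 =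
            z ^+ 2 * ((-1) ^+ e * (m ^ f * q ^ g)%:R).
    have sqX (b : bool) (x : algC) : (x ^+ b) ^+ 2 = (x ^+ 2) ^+ b.
      by case: b; rewrite ?expr0 ?expr1n ?expr1.
    by rewrite !exprMn !sqX sqrCi !sqrtn2 [(m ^ f * q ^ g)%:R]natrM !natrX !mulrA.
  rewrite /N natrM; case: z2 => ->; case: e {wQ w2}; rewrite ?expr0 ?expr1.
  - by right; ring.
  - by left; ring.
  - by left; ring.
  - by right; ring.
case=> // E; move: w2; rewrite E oppr_ge0 lern0 => /eqP N00.
by rewrite N00 in N0.
Qed.

(** For 2 and [2 * p1] the valuation at 2 of [n * m ^ f * q ^ g] is odd; for [p1] its valuations at
    [p1] and [p2] have opposite parities. *)
Lemma K3_not_sqr z n : L z -> n \in [:: 2; p1; 2 * p1]%N ->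
  z ^+ 2 = n%:R \/ z ^+ 2 = - n%:R -> False.
Proof.
move=> Lz nE z2; have n0 : (0 < n)%N.
  by move: nE; rewrite !inE => /or3P[] /eqP ->; rewrite ?muln_gt0 ?prime_gt0.
have [f [g ev]] := K3_sqr_parity Lz n0 z2.
have [[p12 p1q] p2q] := (K3_p12 hyp, K3_p1q hyp, K3_p2q hyp).
have [[h1 h2] h3] := (K3_p1_mod hyp, K3_p2_mod hyp, K3_q_mod hyp).
have n21 : 2%N <> p1 by move=> e; rewrite -e in h1.
have n22 : 2%N <> p2 by move=> e; rewrite -e in h2.
have n23 : 2%N <> q by move=> e; rewrite -e in h3.
have E p : odd (logn p (n * (m ^ f * q ^ g))) =
    odd (logn p n) (+) (f && ((p == p1) (+) (p == p2))) (+) (g && (p == q)).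
  have m0 : (0 < m ^ f)%N by rewrite expn_gt0 muln_gt0 !prime_gt0.
  have q0 : (0 < q ^ g)%N by rewrite expn_gt0 prime_gt0.
  have mq0 : (0 < m ^ f * q ^ g)%N by rewrite muln_gt0 m0.
  rewrite (lognM p n0 mq0) (lognM p m0 q0) !lognX.
  rewrite (lognM p (prime_gt0 pp1) (prime_gt0 pp2)) (logn_prime _ pp1) (logn_prime _ pp2)
    (logn_prime _ pq).
  by rewrite !oddD !oddM oddD !oddb addbA.
have neq a b : a <> b :> nat -> (a == b = false) * (b == a = false).
  by move=> ab; split; apply/eqP => // /esym.
have l2 p : odd (logn p (2 * p1)) = (p == 2%N) (+) (p == p1).
  by rewrite lognM ?prime_gt0 // !logn_prime // oddD !oddb.
move: (ev 2%N) (ev p1) (ev p2); rewrite !E.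
rewrite !(neq _ _ p12, neq _ _ p1q, neq _ _ p2q, neq _ _ n21, neq _ _ n22, neq _ _ n23) !eqxx.
move: nE; rewrite !inE => /or3P[] /eqP ->; rewrite ?l2 ?logn_prime //.
- by rewrite eqxx /= !andbF.
- rewrite !(neq _ _ p12, neq _ _ n21) eqxx !andbF !andbT /=.
  by case: (f).
- by rewrite !(neq _ _ n21) eqxx !andbF.
Qed.

Lemma root4_cases (z : algC) : z ^+ 4 = 1 -> z ^+ 2 = 1 \/ z = 'i \/ z = - 'i.
Proof.
move=> z4; have : (z ^+ 2) ^+ 2 = 1 ^+ 2 by rewrite -exprM z4 expr1n.
move/eqP; rewrite eqf_sqr => /orP[]/eqP; first by left.
by rewrite -sqrCi => /eqP; rewrite eqf_sqr => /orP[]/eqP; right; [left | right].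
Qed.

(** L has no primitive eighth root of unity: since [(1 + 'i) ^+ 2 = 2 * 'i], a square root of ['i]
    or [- 'i] would make 2 or -2 a square. *)
Lemma K3_root_unity z c : L z -> c ^+ 4 = 1 -> z ^+ 2 = c -> c ^+ 2 = 1.
Proof.
move=> Lz c4 z2; have Lw : L ((1 + 'i) * z).
  by apply: (subfieldM hL) => //; apply: (subfieldD hL); [exact: subfield1 | exact: K3_Li].
have w2 : ((1 + 'i) * z) ^+ 2 = 2 * 'i * c.
  have -> : 2 * 'i = (1 + 'i) ^+ 2 :> algC by rewrite sqrrD sqrCi expr1n; ring.
  by rewrite exprMn z2.
case: (root4_cases c4) => // cE; exfalso.
apply: (@K3_not_sqr _ 2 Lw) => //; rewrite w2.
by case: cE => ->; [right | left]; rewrite ?mulrN -mulrA -expr2 sqrCi; ring.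
Qed.

(** When [c] is ['i] or [- 'i], the factor [1 + 'i] turns [z] into a square root of [2 * p1] up to
    sign; otherwise [z] is a square root of [p1] up to sign. *)
Lemma K3_root_p1 z c : L z -> c ^+ 4 = 1 -> z ^+ 2 <> c * p1%:R.
Proof.
move=> Lz c4 z2; have Lw : L ((1 + 'i) * z).
  by apply: (subfieldM hL) => //; apply: (subfieldD hL); [exact: subfield1 | exact: K3_Li].
have w2 : ((1 + 'i) * z) ^+ 2 = 2 * 'i * (c * p1%:R).
  have -> : 2 * 'i = (1 + 'i) ^+ 2 :> algC by rewrite sqrrD sqrCi expr1n; ring.
  by rewrite exprMn z2.
case: (root4_cases c4) => [/eqP|cE].
  rewrite sqrf_eq1 => cE; apply: (@K3_not_sqr _ p1 Lz); first by rewrite !inE eqxx orbT.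
  by rewrite z2; case/orP: cE => /eqP ->; [left | right]; ring.
apply: (@K3_not_sqr _ (2 * p1)%N Lw); first by rewrite !inE eqxx !orbT.
rewrite w2 natrM; case: cE => ->; [right | left].
  have -> : 2 * 'i * ('i * p1%:R) = 2 * p1%:R * 'i ^+ 2 :> algC by ring.
  by rewrite sqrCi; ring.
have -> : 2 * 'i * (- 'i * p1%:R) = - (2 * p1%:R * 'i ^+ 2) :> algC by ring.
by rewrite sqrCi; ring.
Qed.

End K3Squares.

(** * Units of rings of integers *)

Lemma int_unitM K x y : is_subfield K -> int_unit K x -> int_unit K y -> int_unit K (x * y).
Proof.
move=> hK [x0 Ox Oxi] [y0 Oy Oyi]; split; rewrite ?mulf_neq0 // ?invfM;
  exact: ring_of_intM.
Qed.

Lemma int_unitV K x : int_unit K x -> int_unit K x^-1.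
Proof. by move=> [x0 Ox Oxi]; split; rewrite ?invr_eq0 // invrK. Qed.

Lemma int_unit1 K : is_subfield K -> int_unit K 1.
Proof. by move=> hK; split; rewrite ?oner_neq0 ?invr1 //; exact: ring_of_int1. Qed.

Lemma int_unitX K x n : is_subfield K -> int_unit K x -> int_unit K (x ^+ n).
Proof.
move=> hK Ux; elim: n => [|n IH]; first by rewrite expr0; exact: int_unit1.
by rewrite exprS; exact: int_unitM.
Qed.

Lemma int_unitXz K x (n : int) : is_subfield K -> int_unit K x -> int_unit K (x ^ n).
Proof.
move=> hK Ux; case: n => n; first by rewrite -exprnP; exact: int_unitX.
by rewrite NegzE -exprnN; apply: int_unitV; exact: int_unitX.
Qed.

Lemma int_unit_sqrt K x : is_subfield K -> K x -> int_unit K (x ^+ 2) -> int_unit K x.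
Proof.
move=> hK Kx [x0 [_ Ax] [_ Axi]]; rewrite sqrf_eq0 in x0.
rewrite -exprVn in Axi.
by split=> //; split; [|exact: Aint_sqr| exact: subfieldV | exact: Aint_sqr].
Qed.

Lemma int_unit_root4 K c : is_subfield K -> K c -> c ^+ 4 = 1 -> int_unit K c.
Proof.
move=> hK Kc c4; apply: int_unit_sqrt => //; apply: int_unit_sqrt => //.
  exact: subfieldX.
by rewrite -exprM c4; exact: int_unit1.
Qed.

Lemma int_unit_neq0 K x : int_unit K x -> x != 0. Proof. by case. Qed.
Lemma int_unit_mem K x : int_unit K x -> K x. Proof. by case=> _ []. Qed.
Lemma int_unit_Aint K x : int_unit K x -> x \in Aint. Proof. by case=> _ []. Qed.
Lemma int_unit_sub K K' x : K `<=` K' -> int_unit K x -> int_unit K' x.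
Proof. by move=> KK [x0 [Kx Ax] [Kxi Axi]]; split=> //; split=> //; exact: KK. Qed.

(** Signs are represented by elements [c] with [c ^+ 2 = 1], which makes them easy to multiply and
    invert. *)
Lemma sqr_eq_sign (x y : algC) : x ^+ 2 = y ^+ 2 -> exists2 c, c ^+ 2 = 1 & x = c * y.
Proof.
move/eqP; rewrite eqf_sqr => /orP[]/eqP ->; [exists 1 | exists (-1)];
  by rewrite ?sqrrN ?expr1n ?mul1r ?mulN1r.
Qed.

(** * Units of L and positive units of norm one in Q(sqrt q) *)

Section K3Units.

Variables (p1 p2 q : nat) (s t : {rmorphism algC -> algC}).
Hypothesis hyp : K3_setting p1 p2 q s t.

Local Notation L := (field_K3 p1 p2 q).
Local Notation sm := (sqrtn (p1 * p2)).
Local Notation sq := (sqrtn q).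
Local Notation conjR := (Num.conj : {rmorphism algC -> algC}).

Let pp1 := K3_p1 hyp.
Let pp2 := K3_p2 hyp.
Let pq := K3_q hyp.
Let hk := K3_k_subfield p1 p2 q.
Let hL := K3_L_subfield p1 p2 q.

Lemma K3_unit_aut (f : {rmorphism algC -> algC}) x : int_unit L x -> int_unit L (f x).
Proof.
move=> [x0 [Lx Ax] [Lxi Axi]]; split; first by rewrite fmorph_eq0.
  by split; [exact: (K3_stable hyp) | rewrite Aint_aut].
by rewrite -fmorphV; split; [exact: (K3_stable hyp) | rewrite Aint_aut].
Qed.

Lemma K3_q_sub : adj Qset sq `<=` L.
Proof. apply: K3_sub_quad; exact: K3_Lq. Qed.
Lemma K3_m_sub : adj Qset sm `<=` L.
Proof. apply: K3_sub_quad; exact: K3_Lm hyp. Qed.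

(** [s] restricts to the nontrivial automorphism of Q(sqrt q), so the last condition says that [v]
    has norm 1. *)
Definition q_unit v := [/\ adj Qset sq v, 0 < v, int_unit L v & s v = v^-1].

Lemma Qsq_subfield : is_subfield (adj Qset sq).
Proof. by apply: adj_subfield; [exact: Qset_subfield | rewrite sqrtn2; exact: rpred_nat]. Qed.

Lemma Qsm_subfield : is_subfield (adj Qset sm).
Proof. by apply: adj_subfield; [exact: Qset_subfield | rewrite sqrtn2; exact: rpred_nat]. Qed.

(** By [unit_trace], [v] is a positive integer [n] up to squares in Q(sqrt q); only 2 and [q] can
    occur in [n] to an odd power, and [q] is itself a square there. *)
Lemma K3_q_class v : q_unit v ->
  exists w, [/\ adj Qset sq w, 0 < w & w ^+ 2 = v \/ w ^+ 2 = 2 * v].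
Proof.
move=> [Qv v0 Uv sv].
have [n [b [n0 Qb nb vn]]] := unit_trace (K3_sq hyp) Qv v0 (int_unit_Aint Uv) sv.
have n2q : 2%N <> q by move=> e; have := K3_q_mod hyp; rewrite -e.
have ev p : prime p -> p <> 2%N -> p <> q -> ~~ odd (logn p n).
  move=> pp np2 npq; apply: (trace_sqr_logn n0 _ Qb nb) => //; first exact: prime_gt0.
  rewrite Euclid_dvdM // !dvdn_prime2 //.
  by apply/norP; split; apply/eqP.
have [e [f [r r0 rE]]] := logn_parity_class (isT : prime 2) pq n2q n0 ev.
have r0' : 0 < r%:R :> algC by rewrite ltr0n.
have sqf0 : 0 < sq ^+ f by rewrite exprn_gt0 // sqrtC_gt0 ltr0n prime_gt0.
pose c : algC := (2 ^ e * q ^ f)%:R.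
have c0 : 0 < c by rewrite ltr0n muln_gt0 !expn_gt0 /= (prime_gt0 pq).
(* With [n c = r^2] and [c = 2^e q^f], the square of this witness is [2^e v]. *)
exists ((1 + v) * c / (r%:R * sq ^+ f)); split.
- have hQ := Qsq_subfield; apply: (subfield_div hQ); apply: (subfieldM hQ).
  + by apply: (subfieldD hQ) => //; exact: subfield1.
  + exact: subfield_nat.
  + exact: subfield_nat.
  + by apply: (subfieldX hQ); apply: adj_gen; exact: Qset_subfield.
- by rewrite divr_gt0 ?mulr_gt0 ?addr_gt0 ?ltr01.
- have E : ((1 + v) * c / (r%:R * sq ^+ f)) ^+ 2 = 2 ^+ e * v.
    have qf : (sq ^+ f) ^+ 2 = q%:R ^+ f.
      by case: (f); rewrite ?expr0 ?expr1n ?expr1 ?sqrtn2.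
    have r2 : r%:R ^+ 2 = n%:R * c :> algC by rewrite -natrX -rE natrM.
    rewrite expr_div_n !exprMn -vn qf r2 /c natrM !natrX; field.
    by rewrite !expf_neq0 ?pnatr_eq0 -?lt0n // ?prime_gt0.
  by rewrite E; case: (e); rewrite ?expr0 ?mul1r ?expr1; [right | left].
Qed.

(** The norm of [w] squares to 1, and -1 is not the norm of an integer of Q(sqrt q), as [q] is 3
    modulo 4. *)
Lemma K3_q_sqrt v w : q_unit v -> adj Qset sq w -> 0 < w -> w ^+ 2 = v -> q_unit w.
Proof.
move=> [Qv v0 Uv sv] Qw w0 wv; have w0' : w != 0 by rewrite gt_eqF.
have Uw : int_unit L w by apply: int_unit_sqrt; rewrite ?wv //; exact: K3_q_sub.
split=> //; have : (w * s w) ^+ 2 = 1 ^+ 2.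
  by rewrite exprMn -rmorphXn /= wv sv mulfV ?expr1n // gt_eqF.
move/eqP; rewrite eqf_sqr => /orP[]/eqP E; first by apply: (mulfI w0'); rewrite E mulfV.
by case: (quad_norm_neg1 pq (K3_q_mod hyp) (K3_sq hyp) Qw (int_unit_Aint Uw)).
Qed.

(* If [xi = A^*/A] then [xi + xi^-1] is a rational integer of absolute value
   at most 2, so that [xi^3 = 1] or [xi^3 = -1]; cubing is only needed when
   L contains a primitive cube root of unity. *)
Lemma K3_conj_cube A : int_unit L A -> s A = A^-1 -> t A = A \/ t A = A^-1 ->
  exists2 c, c ^+ 2 = 1 & (A ^+ 3)^* = c * A ^+ 3.
Proof.
move=> UA sA tA; pose xi := A^* / A.
have A0 := int_unit_neq0 UA; have LA := int_unit_mem UA.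
have cA0 : A^* != 0 by rewrite conjC_eq0.
have Uxi : int_unit L xi by apply: int_unitM => //; [exact: (K3_unit_aut conjR) |
  exact: int_unitV].
have xi0 := int_unit_neq0 Uxi.
have cE : xi^* = xi^-1 by rewrite /xi fmorph_div /= conjCK invf_div.
have sE : s xi = xi^-1.
  by rewrite /xi fmorph_div /= (K3_comm hyp s conjR LA) /= sA fmorphV invrK invf_div mulrC.
have tE : t xi = xi \/ t xi = xi^-1.
  rewrite /xi fmorph_div /= (K3_comm hyp t conjR LA) /=.
  by case: tA => ->; [left | right]; rewrite ?fmorphV ?invrK ?invf_div // mulrC.
(* [s], [t] and complex conjugation each send [xi] to itself or to its inverse, so this sum is
   rational. *)
have trQ : xi + xi^-1 \in Crat.
  apply: (K3_rational hyp).
  - by apply: (subfieldD hL); [|apply: (subfieldV hL)]; exact: int_unit_mem.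
  - by rewrite rmorphD fmorphV sE invrK addrC.
  - by rewrite rmorphD fmorphV; case: tE => ->; rewrite ?invrK // addrC.
  - by rewrite rmorphD fmorphV /= cE invrK addrC.
have /intrP[N NE] : xi + xi^-1 \in Num.int.
  by apply: Cint_rat_Aint => //; exact: rpredD (int_unit_Aint Uxi)
    (int_unit_Aint (int_unitV Uxi)).
have xin : `|xi| = 1.
  by apply/eqP; rewrite -sqrp_eq1 ?normr_ge0 // normCK cE mulfV.
have Nle : (`|N| <= 2)%R.
  rewrite -(ler_int algC) intr_norm -NE (le_trans (ler_normD _ _)) //.
  by rewrite normfV xin invr1.
have quad : xi ^+ 2 = N%:~R * xi - 1 by rewrite -NE; field.
have c3 : exists2 c, c ^+ 2 = 1 & xi ^+ 3 = c.
  have cube : xi ^+ 3 = (N ^+ 2 - 1)%:~R * xi - N%:~R.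
    rewrite exprSr quad mulrBl mul1r -mulrA -expr2 quad rmorphB rmorphXn /=; ring.
  have : N \in [:: -2; -1; 0; 1; 2] by rewrite !inE; lia.
  rewrite !inE => /or4P[/eqP e|/eqP e|/eqP e|/orP[]/eqP e]; rewrite e in quad cube.
  - have : (xi + 1) ^+ 2 = 0 by rewrite sqrrD quad; ring.
    move/eqP; rewrite sqrf_eq0 addr_eq0 => /eqP xiE.
    by exists (-1); rewrite ?sqrrN ?expr1n // xiE; ring.
  - by exists 1; rewrite ?expr1n // cube; ring.
  (* Here [xi] is ['i] up to sign, which [s] fixes, whereas [s] inverts [xi]. *)
  - exfalso; have : xi ^+ 2 = 'i ^+ 2 by rewrite quad sqrCi; ring.
    move=> x2; have : s xi = xi.
      by case/sqr_eq_sign: x2 => c /eqP; rewrite sqrf_eq1 => /orP[]/eqP -> ->;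
        rewrite rmorphM ?rmorphN rmorph1 (K3_si hyp).
    rewrite sE => xx; have : xi ^+ 2 = 1 by rewrite expr2 -[X in X * _]xx mulVf.
    by rewrite quad mul0r sub0r => /eqP; rewrite -subr_eq0 -opprD oppr_eq0 (pnatr_eq0 _ 2).
  - by exists (-1); rewrite ?sqrrN ?expr1n // cube; ring.
  - have : (xi - 1) ^+ 2 = 0 by rewrite sqrrB quad; ring.
    move/eqP; rewrite sqrf_eq0 subr_eq0 => /eqP xiE.
    by exists 1; rewrite ?expr1n // xiE; ring.
case: c3 => c c2 cE'; exists c => //.
by rewrite -cE' /xi expr_div_n divfK ?expf_neq0 // rmorphXn.
Qed.

End K3Units.

(** * Units of relative norm one over k *)

Section K3Capitulation.

Variables (p1 p2 q : nat) (s t : {rmorphism algC -> algC}).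
Hypothesis hyp : K3_setting p1 p2 q s t.

Local Notation m := (p1 * p2)%N.
Local Notation k := (field_k p1 p2 q).
Local Notation L := (field_K3 p1 p2 q).
Local Notation sm := (sqrtn (p1 * p2)).
Local Notation sq := (sqrtn q).
Local Notation sd := (sqrtn (p1 * p2 * q)).
Local Notation conjR := (Num.conj : {rmorphism algC -> algC}).

Let pp1 := K3_p1 hyp.
Let pp2 := K3_p2 hyp.
Let pq := K3_q hyp.
Let hk := K3_k_subfield p1 p2 q.
Let hL := K3_L_subfield p1 p2 q.

Variable eta : algC.
Hypotheses (eta_fund : fundamental_unit m eta) (s_eta : s eta = eta^-1).

Lemma eta_gt1 : 1 < eta. Proof. by case: eta_fund. Qed.
Lemma eta_unit_quad : int_unit (quad_field m) eta. Proof. by case: eta_fund. Qed.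
Lemma quad_m_sub : quad_field m `<=` L.
Proof. by rewrite quad_fieldE; exact: (K3_m_sub hyp). Qed.
Lemma eta_unit : int_unit L eta.
Proof. apply: int_unit_sub eta_unit_quad; exact: quad_m_sub. Qed.
Lemma eta_neq0 : eta != 0. Proof. exact: int_unit_neq0 eta_unit. Qed.

Lemma s_etaX (j : int) : s (eta ^ j) = (eta ^ j)^-1.
Proof. by rewrite fmorphXz /= s_eta exprz_inv -invr_expz. Qed.

(** A square root would be a unit, hence [eta ^ j] up to sign, and [eta ^ (2 j) = eta] is impossible
    for [eta > 1]. *)
Lemma eta_not_sqr w : quad_field m w -> w ^+ 2 <> eta.
Proof.
move=> Qw w2; case: eta_fund => _ _ gen.
have hQ : is_subfield (quad_field m) by exact: field_gen_subfield.
have Uw : int_unit (quad_field m) w.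
  by apply: int_unit_sqrt => //; rewrite w2; exact: eta_unit_quad.
have [j wj] := gen _ Uw; have E : eta ^ j * eta ^ j = eta.
  by rewrite -[RHS]w2 expr2; case: wj => ->; rewrite ?mulrNN.
have e1 := eta_gt1; have e0 : 0 < eta := lt_trans ltr01 e1.
case: j {wj} E => j; last first.
  rewrite NegzE -exprnN -invfM -exprD => E.
  have : eta < 1.
    by rewrite -[X in X < _]E invf_lt1 ?exprn_gt0 // exprn_egt1 // addSn.
  by move=> /(lt_trans e1); rewrite ltxx.
rewrite -!exprnP -exprD addnn; case: j => [|j] E.
  by move: e1; rewrite -E expr0 ltxx.
have : eta ^+ 1 < eta ^+ j.+1.*2 by rewrite ltr_eXn2l // doubleS.
by rewrite E expr1 ltxx.
Qed.

(** Modulo squares of Q(sqrt m), [eta] is [c = p1 ^ e * p2 ^ f], the valuation at 2 being even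
    because [m] is 1 modulo 4. Were [c] equal to 1 or [m], [eta] would be a square; so [c] is [p1]
    or [p2], and dividing [sm * eta] by the root found gives the other one. *)
Lemma eta_roots : exists b b', [/\ L b, L b', b ^+ 2 = p1%:R * eta & b' ^+ 2 = p2%:R * eta].
Proof.
have e1 := eta_gt1; have e0 : 0 < eta := lt_trans ltr01 e1.
have Qe : adj Qset sm eta by rewrite -quad_fieldE; exact: int_unit_mem eta_unit_quad.
have [n [b [n0 Qb nb vn]]] := unit_trace (K3_sm hyp) Qe e0 (int_unit_Aint eta_unit) s_eta.
have m0 : (0 < m)%N by rewrite muln_gt0 !prime_gt0.
have m4 : (m %% 4 = 1)%N by rewrite -modnMml -modnMmr (K3_p1_mod hyp) (K3_p2_mod hyp).
have rm : radical_nat m.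
  apply: radical_mul; [|exact: radical_prime | exact: radical_prime].
  by rewrite prime_coprime // dvdn_prime2 //; apply/eqP; exact: K3_p12 hyp.
have ev p : prime p -> p <> p1 -> p <> p2 -> ~~ odd (logn p n).
  move=> pp np1 np2; have [->|np] := eqVneq p 2%N.
    exact: (trace_sqr_logn2 n0 m0 Qb nb).
  apply: (trace_sqr_logn n0 m0 Qb nb) => //.
  rewrite !Euclid_dvdM // !dvdn_prime2 // (negPf np) /=.
  by apply/norP; split; apply/eqP.
have [e [f [r r0 rE]]] := logn_parity_class pp1 pp2 (K3_p12 hyp) n0 ev.
have [c cE] : exists c : algC, c = (p1 ^ e * p2 ^ f)%:R by exists (p1 ^ e * p2 ^ f)%:R.
pose w := (1 + eta) * c / r%:R.
have hQ := @Qsm_subfield p1 p2.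
have Qw : adj Qset sm w.
  apply: (subfield_div hQ); last exact: subfield_nat.
  by apply: (subfieldM hQ); [apply: (subfieldD hQ) => //; exact: subfield1 | rewrite cE;
    exact: subfield_nat].
have Lw : L w by exact: (K3_m_sub hyp).
have r0' : r%:R != 0 :> algC by rewrite pnatr_eq0 -lt0n.
have n0' : n%:R != 0 :> algC by rewrite pnatr_eq0 -lt0n.
have p10 : p1%:R != 0 :> algC by rewrite pnatr_eq0 -lt0n prime_gt0.
have p20 : p2%:R != 0 :> algC by rewrite pnatr_eq0 -lt0n prime_gt0.
have c0 : c != 0 by rewrite cE pnatr_eq0 -lt0n muln_gt0 !expn_gt0 !prime_gt0.
have w2 : w ^+ 2 = c * eta.
  have r2 : r%:R ^+ 2 = n%:R * c :> algC by rewrite -natrX -rE natrM cE.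
  by rewrite expr_div_n exprMn -vn r2; field; rewrite c0.
have sm2 : sm ^+ 2 = p1%:R * p2%:R by rewrite sqrtn2 natrM.
have en0 := eta_neq0; have sm0 := K3_sm0 hyp.
have w0 : w != 0 by rewrite -sqrf_eq0 w2 mulf_neq0.
have Lb : L (sm * eta / w).
  apply: (subfield_div hL) => //; apply: (subfieldM hL); first exact: K3_Lm hyp.
  exact: int_unit_mem eta_unit.
have b2 : (sm * eta / w) ^+ 2 = p1%:R * p2%:R * eta / c.
  by rewrite expr_div_n exprMn sm2 w2; field; rewrite ?c0 ?en0.
clearbody w; case: e f {rE} cE => [] []; rewrite ?expn1 ?expn0 ?mul1n ?muln1 => cE;
  rewrite cE in w2 b2.
- exfalso; apply: (@eta_not_sqr (w / sm)).
    by rewrite quad_fieldE; apply: (subfield_div hQ) => //; apply: adj_gen;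
      exact: Qset_subfield.
  by rewrite expr_div_n w2 sm2 natrM; field; rewrite ?p10 ?p20.
- exists w, (sm * eta / w); split=> //; rewrite b2; by field.
- exists (sm * eta / w), w; split=> //; rewrite b2; by field.
- exfalso; apply: (@eta_not_sqr w); first by rewrite quad_fieldE.
  by rewrite w2 mul1r.
Qed.

Variables (b b' : algC).
Hypotheses (Lb : L b) (Lb' : L b') (b2 : b ^+ 2 = p1%:R * eta) (b'2 : b' ^+ 2 = p2%:R * eta).

Let p10 : p1%:R != 0 :> algC. Proof. by rewrite pnatr_eq0 -lt0n prime_gt0. Qed.
Let p20 : p2%:R != 0 :> algC. Proof. by rewrite pnatr_eq0 -lt0n prime_gt0. Qed.

Lemma beta_neq0 : b != 0. Proof. by rewrite -sqrf_eq0 b2 mulf_neq0 // eta_neq0. Qed.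
Lemma beta'_neq0 : b' != 0. Proof. by rewrite -sqrf_eq0 b'2 mulf_neq0 // eta_neq0. Qed.

Lemma int_parity (j : int) : exists (i : int) (e : bool), j = i + i + e%:Z.
Proof.
exists (j %/ 2)%Z, ((j %% 2)%Z == 1); have := divz_eq j 2.
have : (j %% 2)%Z = 0 \/ (j %% 2)%Z = 1 by lia.
by case=> ->; rewrite ?eqxx /=; lia.
Qed.

(** For odd [j] the quotient [b * eta ^ i / z] would be a square root of [p1] times a fourth root of
    unity; for even [j], [z / eta ^ i] is a root of unity. *)
Lemma K3_eta_sqrt z c (j : int) : L z -> c ^+ 4 = 1 -> z ^+ 2 = c * eta ^ j ->
  c ^+ 2 = 1 /\ exists i c', c' ^+ 4 = 1 /\ z = c' * eta ^ i.
Proof.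
move=> Lz c4 z2; have [i [e jE]] := int_parity j; have e0 := eta_neq0.
have ei0 : eta ^ i != 0 by rewrite expfz_neq0.
have Lei : L (eta ^ i) by apply: (subfieldXz hL); exact: int_unit_mem eta_unit.
have c0 : c != 0 by apply: contra_eqN c4 => /eqP ->; rewrite expr0n eq_sym oner_eq0.
rewrite jE !expfzDr // in z2; case: e {jE} z2 => z2.
  exfalso; rewrite -exprnP expr1 in z2.
  apply: (K3_root_p1 hyp (z := b * eta ^ i / z) (c := c^-1)).
  - by apply: (subfield_div hL) => //; exact: (subfieldM hL).
  - by rewrite exprVn c4 invr1.
  - by rewrite expr_div_n exprMn b2 z2 (expr2 (eta ^ i)); field; rewrite ?c0 ?ei0 ?e0.
rewrite -exprnP expr0 mulr1 in z2.
have w2 : (z / eta ^ i) ^+ 2 = c by rewrite expr_div_n z2; field.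
have Lw : L (z / eta ^ i) by exact: (subfield_div hL).
have c2 := K3_root_unity hyp Lw c4 w2.
split=> //; exists i, (z / eta ^ i); split; last by rewrite divfK.
by rewrite (exprM _ 2 2) w2.
Qed.

Lemma s_root4 c : c ^+ 4 = 1 -> s c = c.
Proof.
case/root4_cases => [|[->|->]]; rewrite ?rmorphN ?(K3_si hyp) //.
by move/eqP; rewrite sqrf_eq1 => /orP[]/eqP ->; rewrite ?rmorphN rmorph1.
Qed.

(** [s] fixes fourth roots of unity, so [c * y] has relative norm [c ^+ 2] when [y] has relative
    norm 1. *)
Lemma root4_norm1 c y : y != 0 -> c ^+ 4 = 1 -> s y = y^-1 -> s (c * y) = (c * y)^-1 -> c ^+ 2 = 1.
Proof.
move=> y0 c4 sy; rewrite rmorphM (s_root4 c4) sy invfM => /(mulIf _) h.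
have c0 : c != 0 by apply: contra_eqN c4 => /eqP ->; rewrite expr0n eq_sym oner_eq0.
by rewrite expr2 {1}h ?invr_eq0 // mulVf.
Qed.

(** The cube of [A] equals its conjugate up to sign, so the square of this cube is, up to sign, its
    product with its conjugate. This trades [A] for a positive real unit. *)
Lemma conj_unit_sqr A : int_unit L A -> s A = A^-1 -> t A = A \/ t A = A^-1 ->
  exists2 c, c ^+ 2 = 1 &
    [/\ (A ^+ 3) ^+ 2 = c * (A ^+ 3 * (A ^+ 3)^*), 0 < A ^+ 3 * (A ^+ 3)^*,
        int_unit L (A ^+ 3 * (A ^+ 3)^*),
        s (A ^+ 3 * (A ^+ 3)^*) = (A ^+ 3 * (A ^+ 3)^*)^-1
      & (A ^+ 3 * (A ^+ 3)^*)^* = A ^+ 3 * (A ^+ 3)^*].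
Proof.
move=> UA sA tA; have [c c2 cE] := K3_conj_cube hyp UA sA tA.
have UA3 := int_unitX 3 hL UA.
exists c => //; set B := A ^+ 3; split.
- by rewrite cE -/B -[LHS]mul1r -c2; ring.
- by rewrite -(normCK B) exprn_gt0 // normr_gt0 (int_unit_neq0 UA3).
- by apply: (int_unitM hL) => //; exact: (K3_unit_aut hyp conjR).
- rewrite rmorphM (K3_comm hyp s conjR (int_unit_mem UA3)) /= /B !rmorphXn /= sA invfM.
  by rewrite -!exprVn fmorphV.
- by rewrite rmorphM /= conjCK mulrC.
Qed.

(** The square of [u] is [A * B] with [A = u * t u] and [B = u / t u]. The cubes of [A] and [B] are
    determined first; a square root of their product then gives [u ^+ 3]. *)
Lemma norm1_unit_cube u : int_unit L u -> s u = u^-1 ->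
  exists c (j : int) w, [/\ c ^+ 2 = 1, q_unit p1 p2 q s w & u ^+ 3 = c * eta ^ j * w].
Proof.
move=> Uu su; have Lu := int_unit_mem Uu; have u0 := int_unit_neq0 Uu.
have Utu : int_unit L (t u) by exact: (K3_unit_aut hyp).
have tu0 := int_unit_neq0 Utu.
have stu : s (t u) = (t u)^-1 by rewrite (K3_comm hyp s t Lu) su fmorphV.
have ttu : t (t u) = u by exact: (K3_invol hyp).
pose A := u * t u; pose B := u / t u.
have sA : s A = A^-1 by rewrite rmorphM su stu invfM.
have sB : s B = B^-1 by rewrite fmorph_div /= su stu invrK invf_div mulrC.
have tA : t A = A by rewrite rmorphM ttu mulrC.
have tB : t B = B^-1 by rewrite fmorph_div /= ttu invf_div.
have UA : int_unit L A by exact: int_unitM.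
have UB : int_unit L B by apply: int_unitM => //; exact: int_unitV.
have AB : (u ^+ 3) ^+ 2 = A ^+ 3 * B ^+ 3 by rewrite -exprMn /A /B -exprM mulnC exprM;
  congr (_ ^+ _); field.
have UA3 := int_unitX 3 hL UA; have UB3 := int_unitX 3 hL UB.
have Uu3 := int_unitX 3 hL Uu.
have sX (x : algC) : s x = x^-1 -> s (x ^+ 3) = (x ^+ 3)^-1 by move=> h;
  rewrite rmorphXn h exprVn.
have c24 (c : algC) : c ^+ 2 = 1 -> c ^+ 4 = 1 by move=> h; rewrite (exprM _ 2 2) h expr1n.
(* [A] is fixed by [t], so the positive unit [V] lies in Q(sqrt m) and is a power of [eta];
   [K3_eta_sqrt] then extracts [A ^+ 3]. *)
have [c1 [i [c12 AE]]] : exists c i, c ^+ 2 = 1 /\ A ^+ 3 = c * eta ^ i.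
  have [c c2 [A2 V0 UV sV cV]] := conj_unit_sqr UA sA (or_introl tA).
  set V := A ^+ 3 * (A ^+ 3)^* in A2 V0 UV sV cV.
  have tV : t V = V.
    by rewrite rmorphM (K3_comm hyp t conjR (int_unit_mem UA3)) /= rmorphXn /= tA.
  have QV : quad_field m V by rewrite quad_fieldE; exact: (K3_tc_fixed hyp (int_unit_mem UV)).
  have [j Vj] : exists j, V = eta ^ j.
    case: eta_fund => _ e1 /(_ V)[|j [->|VE]]; last 2 first.
    - by exists j.
    - have : 0 < eta ^ j by rewrite exprz_gt0 // (lt_trans ltr01).
      by rewrite -oppr_lt0 -VE => /(lt_trans V0); rewrite ltxx.
    case: UV => V0' [_ AV] [_ AVi]; split=> //; split=> //.
    by apply: (@subfieldV (quad_field m)) => //; exact: field_gen_subfield.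
  rewrite Vj in A2; have [_ [i [c' [c'4 AE]]]] := K3_eta_sqrt (int_unit_mem UA3) (c24 _ c2) A2.
  exists c', i; split=> //; apply: (root4_norm1 (y := eta ^ i)) => //.
  - by rewrite expfz_neq0 // eta_neq0.
  - exact: s_etaX.
  - by rewrite -AE sX.
(* [B] is inverted by both [s] and [t], so [V] is fixed by [s \o t] and lies in Q(sqrt q). It is a
   square there, since the alternative makes 2 a square in L up to sign. *)
have [c2 [w [c22 qw BE]]] : exists c w, [/\ c ^+ 2 = 1, q_unit p1 p2 q s w & B ^+ 3 = c * w].
  have [c c2 [B2 V0 UV sV cV]] := conj_unit_sqr UB sB (or_intror tB).
  set V := B ^+ 3 * (B ^+ 3)^* in B2 V0 UV sV cV.
  have stV : s (t V) = V.
    have -> : t V = V^-1.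
      rewrite rmorphM (K3_comm hyp t conjR (int_unit_mem UB3)) /= rmorphXn /= tB.
      by rewrite exprVn fmorphV -invfM.
    by rewrite fmorphV sV invrK.
  have qV : q_unit p1 p2 q s V by split=> //; exact: (K3_stc_fixed hyp (int_unit_mem UV)).
  have [w [Qw w0 wV]] := K3_q_class hyp qV; have w0' : w != 0 by rewrite gt_eqF.
  have Lw : L w by apply: (@K3_q_sub p1 p2 q).
  have B0 := int_unit_neq0 UB3; have V0' := int_unit_neq0 UV.
  case: wV => wV; last first.
    exfalso; apply: (K3_not_sqr hyp (z := w / B ^+ 3) (n := 2)); rewrite ?inE //.
      by apply: (subfield_div hL) => //; exact: int_unit_mem.
    have c0 : c != 0 by rewrite -sqrf_eq0 c2 oner_eq0.
    have -> : (w / B ^+ 3) ^+ 2 = 2 / c by rewrite expr_div_n wV B2; field; rewrite c0.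
    by move/eqP: c2; rewrite sqrf_eq1 => /orP[]/eqP ->; [left | right]; field.
  have qw := K3_q_sqrt hyp qV Qw w0 wV.
  rewrite -wV in B2; exists (B ^+ 3 / w), w; split=> //; last by rewrite divfK.
  have cE : (B ^+ 3 / w) ^+ 2 = c by rewrite expr_div_n B2 mulfK // expf_neq0.
  apply: (root4_norm1 (y := w)) => //.
  - by rewrite (exprM _ 2 2) cE.
  - by case: qw.
  - by rewrite divfK // sX.
have [Qw w0 Uw sw] := qw; have [w1 [Qw1 w10 w1E]] := K3_q_class hyp qw.
have Lw1 : L w1 by apply: (@K3_q_sub p1 p2 q).
have w10' : w1 != 0 by rewrite gt_eqF.
have c2' : (c1 * c2) ^+ 2 = 1 by rewrite exprMn c12 c22 mulr1.
have u2 : (u ^+ 3) ^+ 2 = c1 * c2 * eta ^ i * w by rewrite AB AE BE; ring.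
have Lu3 := int_unit_mem Uu3.
case: w1E => w1E.
  have z2 : (u ^+ 3 / w1) ^+ 2 = c1 * c2 * eta ^ i.
    by rewrite expr_div_n u2 w1E mulfK // (int_unit_neq0 Uw).
  have [_ [j [c [c4 zE]]]] := K3_eta_sqrt (subfield_div hL Lu3 Lw1) (c24 _ c2') z2.
  have qw1 := K3_q_sqrt hyp qw Qw1 w10 w1E.
  exists c, j, w1; split=> //; last by rewrite -zE divfK.
  apply: (root4_norm1 (y := eta ^ j * w1)) => //.
  - by rewrite mulf_neq0 // expfz_neq0 // eta_neq0.
  - by rewrite rmorphM s_etaX invfM; case: qw1 => _ _ _ ->.
  - by rewrite mulrA -zE divfK // sX.
(* If [2 * w] is a square, the factor [1 + 'i] gives a square root of ['i] times a power of [eta],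
   up to sign, against [K3_eta_sqrt]. *)
exfalso; have L1i : L (1 + 'i) by apply: (subfieldD hL); [exact: subfield1 | exact: K3_Li].
have z2 : (u ^+ 3 * (1 + 'i) / w1) ^+ 2 = c1 * c2 * 'i * eta ^ i.
  have i2 : (1 + 'i) ^+ 2 = 2 * 'i :> algC by rewrite sqrrD sqrCi expr1n; ring.
  by rewrite expr_div_n exprMn u2 w1E i2; field; rewrite (int_unit_neq0 Uw).
have ci4 : (c1 * c2 * 'i) ^+ 4 = 1.
  by rewrite exprMn c24 // mul1r (exprM _ 2 2) sqrCi sqrrN expr1n.
have [] := K3_eta_sqrt (subfield_div hL (subfieldM hL Lu3 L1i) Lw1) ci4 z2.
rewrite exprMn c2' mul1r sqrCi => /eqP; rewrite -subr_eq0 -opprD oppr_eq0.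
by rewrite (pnatr_eq0 _ 2).
Qed.

(** * Generators of capitulating ideals, up to factors in k and units of L *)

Lemma sign_unit c : c ^+ 2 = 1 -> int_unit L c.
Proof.
move=> c2; apply: int_unit_sqrt => //; last by rewrite c2; exact: int_unit1.
by move/eqP: c2; rewrite sqrf_eq1 => /orP[]/eqP ->; [|apply: (subfieldN hL)]; exact: subfield1.
Qed.

Lemma i_unit : int_unit L 'i.
Proof.
apply: int_unit_root4 => //; first exact: K3_Li.
by rewrite (exprM _ 2 2) sqrCi sqrrN expr1n.
Qed.

(** The first claim compares squares. For the second, a square root of [2 * w] divided by [1 + 'i]
    is a unit, since its square is [w / 'i]. *)
Lemma q_unit_root w w' : q_unit p1 p2 q s w -> L w' -> w' != 0 ->
    w' ^+ 2 = w \/ w' ^+ 2 = 2 * w ->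
  (exists2 c, c ^+ 2 = 1 & s w' = c * (w' / w)) /\
  exists r v, [/\ k r, r != 0, int_unit L v & w'^-1 = r * v].
Proof.
move=> [Qw w0 Uw sw] Lw' w'0 w'E; have wn0 := int_unit_neq0 Uw; split.
  apply: sqr_eq_sign; rewrite expr_div_n -rmorphXn /=.
  by case: w'E => ->; rewrite ?rmorphM ?rmorph_nat sw; field.
case: w'E => w'E.
  exists 1, w'^-1; split; [exact: subfield1 | exact: oner_neq0 | | by rewrite mul1r].
  by apply: int_unitV; apply: int_unit_sqrt => //; rewrite w'E.
have i2 : (1 + 'i) ^+ 2 = 2 * 'i :> algC by rewrite sqrrD sqrCi expr1n; ring.
have n0 : 1 + 'i != 0 :> algC.
  by rewrite -sqrf_eq0 i2 mulf_neq0 ?pnatr_eq0 // neq0Ci.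
have k1 : k (1 + 'i) by apply: (subfieldD hk); [exact: subfield1 | exact: K3_ki].
exists (1 + 'i)^-1, (w' / (1 + 'i))^-1; split.
- exact: (subfieldV hk).
- by rewrite invr_eq0.
- apply: int_unitV; apply: int_unit_sqrt => //.
    by apply: (subfield_div hL) => //; exact: K3_kL.
  have -> : (w' / (1 + 'i)) ^+ 2 = w / 'i by rewrite expr_div_n w'E i2; field; rewrite neq0Ci.
  by apply: int_unitM => //; apply: int_unitV; exact: i_unit.
- by field; rewrite ?w'0 ?n0.
Qed.

(** Since [b ^+ 2 = p1 * eta], only the parity of [j] matters modulo [k] and units. *)
Lemma beta_power (j : int) : exists r (e : bool) v,
  [/\ k r, r != 0, int_unit L v & b ^ j = r * b ^+ e * v].
Proof.
have [i [e ->]] := int_parity j; exists (p1%:R ^ i), e, (eta ^ i); split.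
- by apply: (subfieldXz hk); exact: subfield_nat.
- by rewrite expfz_neq0.
- by apply: int_unitXz => //; exact: eta_unit.
- by rewrite !expfzDr ?beta_neq0 // -expfzMl -expr2 b2 expfzMl -exprnP; ring.
Qed.

Lemma s_beta : exists2 c, c ^+ 2 = 1 & s b = c * (b / eta).
Proof.
apply: sqr_eq_sign; rewrite -rmorphXn /= expr_div_n b2 rmorphM rmorph_nat s_eta.
by field; exact: eta_neq0.
Qed.

Lemma sign_Xz (c : algC) (j : int) : c ^+ 2 = 1 -> (c ^ j) ^+ 2 = 1.
Proof. by move=> c2; rewrite expr2 -expfzMl -expr2 c2 exp1rz. Qed.

(** [b * b' / eta] has square [m], hence is sqrt m up to sign, and [sq^-1 = sm / sd] with [sd] in
    [k]. Thus sqrt q amounts to [b * b'] modulo [k] and units. *)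
Lemma sq_inv : exists2 c, c ^+ 2 = 1 & sq^-1 = c * (b * b') / (eta * sd).
Proof.
have e0 := eta_neq0; have [sm0 sq0] := (K3_sm0 hyp, K3_sq0 hyp).
have : sm ^+ 2 = (b * b' / eta) ^+ 2.
  by rewrite expr_div_n exprMn b2 b'2 sqrtn2 natrM; field.
case/sqr_eq_sign => c c2 smE; exists c => //.
by apply: (mulfI sm0); rewrite K3_sqrtd {1}smE; field; rewrite ?e0 ?sm0 ?sq0.
Qed.

(** Passing from [a] to [a / u] replaces [u] by [u ^+ 3], which is known. The factors [b ^ j] and
    [w'] reduce it to a sign, leaving an element [g] of [k] or of [k] times sqrt q. *)
Lemma capitulation_generator a : L a -> a != 0 -> int_unit L (s a / a) ->
  exists c (e f : bool) v,
    [/\ k c, c != 0, int_unit L v & a = c * (b ^+ e * b' ^+ f) * v].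
Proof.
move=> La a0 Uu; pose u := s a / a; rewrite -/u in Uu; have u0 := int_unit_neq0 Uu.
have sa0 : s a != 0 by rewrite fmorph_eq0.
have su : s u = u^-1 by rewrite fmorph_div /= (K3_invol hyp s La) invf_div.
have [c [j [w [c2 qw uE]]]] := norm1_unit_cube Uu su.
have [w' [Qw' w'0 w'E]] := K3_q_class hyp qw.
have Lw' : L w' by apply: (@K3_q_sub p1 p2 q).
have w'n0 : w' != 0 by rewrite gt_eqF.
have wn0 : w != 0 by case: qw => _ /gt_eqF -> _ _.
have [[c' c'2 sw'] [r' [v' [kr' r'0 Uv' w'V]]]] := q_unit_root qw Lw' w'n0 w'E.
have [c1 c12 sb] := s_beta; have bn0 := beta_neq0; have e0 := eta_neq0.
have [r [e [v [kr r0 Uv bV]]]] := beta_power (- j).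
have bj0 : b ^ j != 0 by rewrite expfz_neq0.
have ej0 : eta ^ j != 0 by rewrite expfz_neq0.
pose g := a / u * (b ^ j * w').
have g0 : g != 0 by rewrite !mulf_neq0 ?invr_eq0.
have Lg : L g.
  apply: (subfieldM hL); first by apply: (subfield_div hL) => //; exact: int_unit_mem Uu.
  by apply: (subfieldM hL) => //; exact: (subfieldXz hL).
have aE : a = g * u * (r * r') * b ^+ e * (v * v').
  have -> : g * u * (r * r') * b ^+ e * (v * v') = g * u * (r * b ^+ e * v) * (r' * v') by ring.
  by rewrite -bV -w'V /g -invr_expz; field; rewrite ?u0 ?bj0 ?w'n0.
(* Up to signs, [s] divides [b ^ j] by [eta ^ j] and [w'] by [w], which cancels [u ^+ 3]. *)
have sg : exists2 C, C ^+ 2 = 1 & s g = C * g.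
  exists (c * c1 ^ j * c'); first by rewrite !exprMn c2 c'2 sign_Xz // !mulr1.
  have sau : s (a / u) = c * eta ^ j * w * (a / u).
    by rewrite -uE fmorph_div /= su /u; field; rewrite a0 sa0.
  rewrite /g rmorphM sau rmorphM fmorphXz /= sb sw' !expfzMl exprz_inv -invr_expz.
  by field; rewrite ?wn0 ?ej0 ?u0.
clearbody g u; case: sg => C /eqP; rewrite sqrf_eq1 => /orP[]/eqP -> sg.
  rewrite mul1r in sg; exists (g * (r * r')), e, false, (u * (v * v')); split.
  - by apply: (subfieldM hk); [exact: (K3_s_fixed hyp) | exact: (subfieldM hk)].
  - by rewrite !mulf_neq0.
  - by do ?[apply: int_unitM => //].
  - by rewrite expr0 mulr1 {1}aE; ring.
(* When [s g = - g], the product [g * sq] lies in [k], and [sq^-1] is rewritten by [sq_inv]. *)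
pose x := g * sq; have sq0 := K3_sq0 hyp; have sm0 := K3_sm0 hyp.
have kx : k x.
  apply: (K3_s_fixed hyp); first by apply: (subfieldM hL) => //; exact: K3_Lq.
  by rewrite rmorphM sg (K3_sq hyp) mulN1r mulrNN.
have sd0 : sd != 0 by rewrite K3_sqrtd mulf_neq0.
have [C3 C32 sqV] := sq_inv.
have gE : g = x * (C3 * (b * b') / (eta * sd)) by rewrite -sqV mulfK.
have Ux : int_unit L (u * (v * v') * C3).
  by apply: int_unitM => //; [do ?[apply: int_unitM => //] | exact: sign_unit].
have kxr : k (x * (r * r') / sd).
  apply: (subfield_div hk); last exact: K3_kd.
  by apply: (subfieldM hk) => //; exact: (subfieldM hk).
have x0 : x != 0 by rewrite mulf_neq0.
(* If [e] is true, the two factors [b] combine into [p1 * eta], leaving only [b']. *)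
clearbody x; case: e {bV} aE => aE.
  exists (x * (r * r') / sd * p1%:R), false, true, (u * (v * v') * C3); split=> //.
  - by apply: (subfieldM hk) => //; exact: subfield_nat.
  - by rewrite !mulf_neq0 ?invr_eq0.
  - rewrite {1}aE gE expr0 !expr1 mul1r.
    have -> : x * (C3 * (b * b') / (eta * sd)) * u * (r * r') * b * (v * v') =
      x * (C3 * (b ^+ 2 * b') / (eta * sd)) * u * (r * r') * (v * v') by ring.
    by rewrite b2; field; rewrite ?sd0 ?e0.
exists (x * (r * r') / sd), true, true, (u * (v * v') * C3 / eta); split=> //.
- by rewrite !mulf_neq0 ?invr_eq0.
- by apply: int_unitM => //; apply: int_unitV; exact: eta_unit.
- by rewrite {1}aE gE expr0 !expr1 mulr1; field; rewrite ?sd0 ?e0.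
Qed.

End K3Capitulation.

(** * The primes above p1 and p2 *)

Lemma bezout_algC (a b : nat) : coprime a b ->
  exists u v : int, u%:~R * a%:R + v%:~R * b%:R = 1 :> algC.
Proof.
move=> ab; have : coprimez a b by rewrite coprimezE !absz_nat.
case/coprimezP=> -[u v] /= uv; exists u, v.
by rewrite -[a%:R]/(a%:~R) -[b%:R]/(b%:~R) -!rmorphM -rmorphD /= uv.
Qed.

Section K3Primes.

Variables (p1 p2 q : nat) (s t : {rmorphism algC -> algC}).
Hypothesis hyp : K3_setting p1 p2 q s t.

Local Notation d := (p1 * p2 * q)%N.
Local Notation k := (field_k p1 p2 q).
Local Notation L := (field_K3 p1 p2 q).
Local Notation sd := (sqrtn (p1 * p2 * q)).
Local Notation conjR := (Num.conj : {rmorphism algC -> algC}).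

Let pp1 := K3_p1 hyp.
Let pp2 := K3_p2 hyp.
Let pq := K3_q hyp.
Let hk := K3_k_subfield p1 p2 q.
Let hL := K3_L_subfield p1 p2 q.

Lemma K3_radical_d : radical_nat d.
Proof.
have [[p12 p1q] p2q] := (K3_p12 hyp, K3_p1q hyp, K3_p2q hyp).
apply: radical_mul; last exact: radical_prime.
  by rewrite coprimeMl !prime_coprime // !dvdn_prime2 //; apply/andP; split; apply/eqP.
apply: radical_mul; [|exact: radical_prime | exact: radical_prime].
by rewrite prime_coprime // dvdn_prime2 //; apply/eqP.
Qed.

Lemma K3_d_gt0 : (0 < d)%N. Proof. by rewrite !muln_gt0 !prime_gt0. Qed.

(** With [Y = a + c * 'i], the numbers [d (2 a)^2] and [d (2 c)^2] are integral combinations of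
    [d Y^2], its conjugate and [d] times the norm of [Y]; as [d] is squarefree, [2 a] and [2 c] are
    integers. *)
Lemma gauss_int_denominator Y : adj Qset 'i Y -> d%:R * Y ^+ 2 \in Aint -> 2 * Y \in Aint.
Proof.
move=> [a [c [Qa Qc YE]]] AY.
have cY : Y^* = a - c * 'i.
  by rewrite YE rmorphD rmorphM /= conjCi !(Qset_fixed conjR) // mulrN.
have AcY : d%:R * Y^* ^+ 2 \in Aint.
  have -> : d%:R * Y^* ^+ 2 = conjR (d%:R * Y ^+ 2) by
    rewrite [RHS]rmorphM rmorphXn rmorph_nat.
  by rewrite Aint_aut.
have AN : d%:R * (Y * Y^*) \in Aint.
  apply: Aint_sqr.
  have -> : (d%:R * (Y * Y^*)) ^+ 2 = (d%:R * Y ^+ 2) * (d%:R * Y^* ^+ 2) by ring.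
  exact: rpredM.
have int2 z : z \in Crat -> d%:R * (2 * z) ^+ 2 \in Aint -> 2 * z \in Aint.
  move=> Qz Az; apply: Aint_Cint; apply: (radical_int K3_d_gt0 K3_radical_d).
    by rewrite rpredM // rpred_nat.
  by apply: Cint_rat_Aint => //; rewrite !(rpredM, rpredX, rpred_nat).
have A2a : 2 * a \in Aint.
  apply: int2 => //.
  have -> : d%:R * (2 * a) ^+ 2 = d%:R * Y ^+ 2 + 2 * (d%:R * (Y * Y^*)) + d%:R * Y^* ^+ 2.
    by rewrite cY YE; ring.
  by rewrite rpredD // rpredD // rpredM // rpred_nat.
have A2c : 2 * c \in Aint.
  apply: int2 => //.
  have -> : d%:R * (2 * c) ^+ 2 = - (d%:R * Y ^+ 2 - 2 * (d%:R * (Y * Y^*)) + d%:R * Y^* ^+ 2).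
    have -> : d%:R * (2 * c) ^+ 2 = - (d%:R * (2 * c) ^+ 2 * 'i ^+ 2) by rewrite sqrCi; ring.
    by rewrite cY YE; ring.
  by rewrite rpredN rpredD // rpredB // rpredM // rpred_nat.
have -> : 2 * Y = 2 * a + 2 * c * 'i by rewrite YE; ring.
by rewrite rpredD // rpredM // Ci_Aint.
Qed.

Variables (p n : nat) (dE : d = (p * n)%N) (pp : prime p) (p_odd : odd p) (pn : coprime p n).

(** * A prime of k above a Gaussian integer of norm p *)

Section OnePrime.

Variables (H : set algC) (pi : algC).
Hypotheses (H_above : prime_lying_above k H pi) (piN : pi * pi^* = p%:R).
Hypothesis Opi : ring_of_int gauss_field pi.

Let hH : int_submodule k H. Proof. by case: H_above => -[]. Qed.

Lemma above_gen : H pi.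
Proof.
case: H_above => _ e; suff : (H `&` ring_of_int gauss_field) pi by case.
rewrite e; exists 1; rewrite ?mulr1 //; apply: ring_of_int1; exact: gauss_subfield.
Qed.

Lemma gauss_sub_k : gauss_field `<=` k.
Proof. by rewrite gauss_fieldE field_kE; apply: adj_sub; exact: Qi_subfield. Qed.

Lemma gauss_conj z : ring_of_int gauss_field z -> ring_of_int gauss_field z^*.
Proof.
move=> [gz Az]; split; last by rewrite (Aint_aut conjR).
move: gz; rewrite gauss_fieldE => -[a [c [Qa Qc ->]]].
rewrite rmorphD rmorphM /= conjCi !(Qset_fixed conjR) //.
by exists a, (- c); split; rewrite ?mulrN ?mulNr // /Qset /= rpredN.
Qed.

(** The square [d] of sqrt d is a multiple of the norm of [pi], hence lies in the prime ideal
    [H]. *)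
Lemma above_sqrtd : H sd.
Proof.
have dH : H (sd * sd).
  have -> : sd * sd = n%:R * pi^* * pi by rewrite -expr2 sqrtn2 dE natrM -piN; ring.
  apply: (submoduleM hH); last exact: above_gen.
  apply: (ring_of_intM hk); first exact: ring_of_int_nat.
  by have [gp Ap] := gauss_conj Opi; split=> //; exact: gauss_sub_k.
have Osd : ring_of_int k sd by split; [exact: K3_kd | exact: sqrtn_Aint].
by case: H_above => -[_ _ _ _ prH] _; case: (prH _ _ Osd Osd dH).
Qed.

(** This reflects the ramification of [pi] in k. For [z = x + y * sd], the Gaussian integer [4 * x]
    lies in [H], hence is a multiple of [pi], as is [d]; so 16 clears the denominator of
    [z ^+ 2 / pi]. So does [p], which is coprime to 16. *)
Lemma above_sqr z : H z -> z ^+ 2 / pi \in Aint.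
Proof.
move=> Hz; have [[_ HO _ _ _] Hg] := H_above.
have [kz Az] := HO _ Hz; have hQi := Qi_subfield; have sd0 : sd != 0.
  by rewrite sqrtn_neq0 // K3_d_gt0.
move: (kz); rewrite field_kE => -[x [y [Qx Qy zE]]].
have tz : t z = x - y * sd.
  by rewrite zE rmorphD rmorphM (K3_td hyp) !(K3_Qi_id (K3_ti hyp)) // mulrN.
have A2x : 2 * x \in Aint.
  have -> : 2 * x = z + t z by rewrite tz zE; ring.
  by rewrite rpredD // Aint_aut.
have A4y : 2 * (2 * y) \in Aint.
  apply: gauss_int_denominator; first by apply: (subfieldM hQi) => //; exact: subfield_nat.
  have -> : d%:R * (2 * y) ^+ 2 = (z - t z) ^+ 2 by rewrite -(sqrtn2 d) tz zE; ring.
  by rewrite rpredX // rpredB // Aint_aut.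
have Og4y : ring_of_int gauss_field (2 * (2 * y)).
  split=> //; rewrite gauss_fieldE.
  by do 2! [apply: (subfieldM hQi); first exact: subfield_nat].
have Og4x : ring_of_int gauss_field (4 * x).
  split; last by have -> : 4 * x = 2 * (2 * x) by [ring]; rewrite rpredM // rpred_nat.
  by rewrite gauss_fieldE; apply: (subfieldM hQi) => //; exact: subfield_nat.
have gk w : ring_of_int gauss_field w -> ring_of_int k w.
  by move=> [gw Aw]; split=> //; exact: gauss_sub_k.
have H4x : H (4 * x).
  have -> : 4 * x = 4 * z - 2 * (2 * y) * sd by rewrite zE; ring.
  apply: (submoduleB hH); apply: (submoduleM hH) => //; last exact: above_sqrtd.
    exact: ring_of_int_nat.
  exact: gk.
have [x' [_ Ax'] xE] : scale_set pi (ring_of_int gauss_field) (4 * x).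
  by rewrite -Hg; split.
have p0 : p%:R != 0 :> algC by rewrite pnatr_eq0 -lt0n prime_gt0.
have pi0 : pi != 0 by apply: contra_neq p0 => pi0; rewrite -piN pi0 mul0r.
have Api := Opi.2; have Acpi : pi^* \in Aint by rewrite (Aint_aut conjR).
have A16 : 16 * (z ^+ 2 / pi) \in Aint.
  have -> : 16 * (z ^+ 2 / pi) =
      pi * x' ^+ 2 + 2 * x' * (2 * (2 * y)) * sd + (2 * (2 * y)) ^+ 2 * (pi^* * n%:R).
    have -> : 16 * (z ^+ 2 / pi) =
       ((4 * x) ^+ 2 + 2 * (4 * x) * (4 * y) * sd + (4 * y) ^+ 2 * sd ^+ 2) / pi.
      by rewrite zE; field.
    by rewrite -xE sqrtn2 dE natrM -piN; field.
  move: A4y; move: (2 * (2 * y)) => Y4 A4y.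
  by rewrite !(rpredD, rpredM, rpredX, rpred_nat) // sqrtn_Aint.
have Ap : p%:R * (z ^+ 2 / pi) \in Aint.
  have -> : p%:R * (z ^+ 2 / pi) = pi^* * z ^+ 2 by rewrite -piN; field.
  by rewrite rpredM // rpredX.
have [u [v uv]] : exists u v : int, u%:~R * 16%:R + v%:~R * p%:R = 1 :> algC.
  by apply: bezout_algC; rewrite (@coprimeXl 4 2 p) // coprime2n.
have -> : z ^+ 2 / pi = u%:~R * (16 * (z ^+ 2 / pi)) + v%:~R * (p%:R * (z ^+ 2 / pi)).
  by move: (z ^+ 2 / pi) => r; rewrite [u%:~R * _]mulrA [v%:~R * _]mulrA -mulrDl uv mul1r.
by apply: rpredD; apply: rpredM => //; exact: Aint_int.
Qed.

End OnePrime.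

(** * The product of the two primes above p, and its extension to L *)

Variables (e f : nat) (pE : p = (e ^ 2 + 4 * f ^ 2)%N) (H H' : set algC).
Hypotheses (H_above : prime_lying_above k H (e%:R + 2 * 'i * f%:R)).
Hypotheses (H'_above : prime_lying_above k H' (e%:R - 2 * 'i * f%:R)).

Local Notation pi := (e%:R + 2 * 'i * f%:R : algC).
Local Notation pi' := (e%:R - 2 * 'i * f%:R : algC).

Let pi_conj : pi^* = pi'.
Proof. by rewrite rmorphD !rmorphM /= conjCi !conjC_nat; ring. Qed.
Let pi'_conj : pi'^* = pi. Proof. by rewrite -pi_conj conjCK. Qed.
Let pi_norm : pi * pi' = p%:R.
Proof.
have -> : pi * pi' = e%:R ^+ 2 - 4 * f%:R ^+ 2 * 'i ^+ 2 by ring.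
by rewrite sqrCi pE natrD natrM !natrX; ring.
Qed.
Let Opi : ring_of_int gauss_field pi.
Proof.
have hg := gauss_subfield; have Oi : ring_of_int gauss_field 'i.
  by split; [apply: field_gen_sub | exact: Ci_Aint].
apply: (ring_of_intD hg); first exact: ring_of_int_nat.
by do 2! [apply: (ring_of_intM hg) => //; try exact: ring_of_int_nat].
Qed.
Let Opi' : ring_of_int gauss_field pi'. Proof. by rewrite -pi_conj; exact: gauss_conj. Qed.
Let piN : pi * pi^* = p%:R. Proof. by rewrite pi_conj. Qed.
Let pi'N : pi' * pi'^* = p%:R. Proof. by rewrite pi'_conj mulrC. Qed.
Let hH : int_submodule k H. Proof. by case: H_above => -[]. Qed.

Lemma above_mul_p : ideal_mul H H' p%:R.
Proof. by rewrite -pi_norm; apply: ideal_mul_mem; exact: above_gen. Qed.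

(** The product contains [pi * sd + sd * pi' = 2 e sd] and [p * sd], and [2 e] is prime to [p]. *)
Lemma above_mul_sqrtd : ideal_mul H H' sd.
Proof.
have hM := ideal_mul_submodule H' hH.
have Hsd := above_sqrtd H_above piN Opi; have H'sd := above_sqrtd H'_above pi'N Opi'.
have M2 : ideal_mul H H' ((2 * e)%:R * sd).
  have -> : (2 * e)%:R * sd = pi * sd + sd * pi' by rewrite natrM; ring.
  by apply: (submoduleD hM); apply: ideal_mul_mem => //; exact: above_gen.
have Mp : ideal_mul H H' (p%:R * sd).
  rewrite mulrC; apply: (submoduleM hM); last exact: above_mul_p.
  by split; [exact: K3_kd | exact: sqrtn_Aint].
(* [e] is positive and smaller than [p], since [f] cannot vanish for a prime [p]. *)
have cop : coprime (2 * e) p.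
  rewrite coprimeMl coprime2n p_odd coprime_sym prime_coprime //.
  have e_odd : odd e by move: p_odd; rewrite pE oddD oddM oddX /= addbF.
  have e0 : (0 < e)%N by rewrite odd_gt0.
  apply/negP => /(dvdn_leq e0); rewrite leqNgt => /negP; apply.
  have f0 : (0 < f)%N.
    rewrite lt0n; apply/eqP => f0; move: pp; rewrite pE f0 -mulnn muln0 addn0.
    by move/primeP => [gt1 /(_ e)]; rewrite dvdn_mulr // => /(_ isT)/orP[]/eqP; nia.
  by rewrite pE; nia.
have [u [v uv]] := bezout_algC cop.
have -> : sd = u%:~R * ((2 * e)%:R * sd) + v%:~R * (p%:R * sd).
  by rewrite [u%:~R * _]mulrA [v%:~R * _]mulrA -mulrDl uv mul1r.
by apply: (submoduleD hM); apply: (submoduleM hM) => //; exact: ring_of_int_int.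
Qed.

(** A product [z * w] is a multiple of [beta], because [(z * w / beta) ^+ 2] is
    [(z ^+ 2 / pi) * (w ^+ 2 / pi') / v]. Conversely [sd = g * beta] with [g ^+ 2 * v = n], so
    [p * beta] and [n * beta] lie in the extension, and [p] and [n] are coprime. *)
Lemma above_ext_gen beta v : L beta -> int_unit L v -> beta ^+ 2 = p%:R * v ->
  ext_gen L (ideal_mul H H') beta.
Proof.
move=> Lb Uv b2; have v0 := int_unit_neq0 Uv.
have p0 : p%:R != 0 :> algC by rewrite pnatr_eq0 -lt0n prime_gt0.
have b0 : beta != 0 by rewrite -sqrf_eq0 b2 mulf_neq0.
have pi0 : pi != 0 by apply: contra_neq p0 => h; rewrite -pi_norm h mul0r.
have pi'0 : pi' != 0 by apply: contra_neq p0 => h; rewrite -pi_norm h mulr0.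
have Ob : ring_of_int L beta.
  split=> //; apply: Aint_sqr; rewrite b2 rpredM ?rpred_nat //; exact: int_unit_Aint Uv.
have Hk x : H x -> k x by case: H_above => -[_ h _ _ _] _ /h[].
have H'k x : H' x -> k x by case: H'_above => -[_ h _ _ _] _ /h[].
apply: ext_gen_intro => //.
  apply: ideal_mul_min; first by case: (scale_submodule beta (ring_of_int_submodule hL)).
  move=> z w Hz Hw; apply/scale_setP => //; split.
    apply: (subfield_div hL) => //; apply: (subfieldM hL); apply: K3_kL;
      [exact: Hk | exact: H'k].
  apply: Aint_sqr.
  have -> : (z * w / beta) ^+ 2 = (z ^+ 2 / pi) * (w ^+ 2 / pi') * v^-1.
    by rewrite expr_div_n b2 -pi_norm; field; rewrite ?v0 ?pi0 ?pi'0.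
  apply: rpredM; last exact: int_unit_Aint (int_unitV Uv).
  by apply: rpredM; [exact: (above_sqr H_above piN Opi Hz) |
    exact: (above_sqr H'_above pi'N Opi' Hw)].
pose g := sd / beta.
have g2 : g ^+ 2 = n%:R / v by rewrite expr_div_n b2 sqrtn2 dE natrM; field; rewrite v0.
have Og : ring_of_int L g.
  split; first by apply: (subfield_div hL) => //; apply: K3_kL; exact: K3_kd.
  by apply: Aint_sqr; rewrite g2 rpredM ?rpred_nat //; exact: int_unit_Aint (int_unitV Uv).
have [A [B AB]] := bezout_algC pn.
have hE := ideal_ext_submodule L (ideal_mul H H').
have -> : beta = A%:~R * beta * p%:R + g * v * B%:~R * sd.
  have -> : g * v * B%:~R * sd = g ^+ 2 * v * B%:~R * beta by rewrite /g; field.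
  rewrite g2; transitivity ((A%:~R * p%:R + B%:~R * n%:R) * beta); first by rewrite AB mul1r.
  by field.
have OI := ring_of_int_int hL.
have Ov : ring_of_int L v by case: Uv.
apply: (submoduleD hE); apply: (submoduleM hE).
- exact: (ring_of_intM hL).
- by apply: ideal_ext_sub; exact: above_mul_p.
- by apply: (ring_of_intM hL) => //; exact: (ring_of_intM hL).
- by apply: ideal_ext_sub; exact: above_mul_sqrtd.
Qed.

Lemma above_fractional : fractional_ideal k (ideal_mul H H').
Proof.
have frac I pi0 : prime_lying_above k I pi0 -> fractional_ideal k I.
  case=> -[hI IO nz _ _] _; split=> //; first by move=> x /IO[].
  exists 1; rewrite oner_neq0; split=> //; first exact: ring_of_int1.
  by move=> x /IO; rewrite mul1r.
by apply: fractional_ideal_mul => //; [exact: frac H_above | exact: frac H'_above].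
Qed.

End K3Primes.

(** * The capitulation kernel *)

Lemma intr_norm_form (x y : int) (D : nat) :
  (x ^+ 2 - D%:Z * y ^+ 2)%:~R = x%:~R ^+ 2 - D%:R * y%:~R ^+ 2 :> algC.
Proof. by rewrite rmorphB /= rmorphXn /= intrM rmorphXn. Qed.

Section K3Kernel.

Variables (p1 p2 q : nat) (s t : {rmorphism algC -> algC}).
Hypothesis hyp : K3_setting p1 p2 q s t.

Local Notation m := (p1 * p2)%N.
Local Notation d := (p1 * p2 * q)%N.
Local Notation k := (field_k p1 p2 q).
Local Notation L := (field_K3 p1 p2 q).
Local Notation sq := (sqrtn q).
Local Notation sd := (sqrtn (p1 * p2 * q)).

Let pp1 := K3_p1 hyp.
Let pp2 := K3_p2 hyp.
Let pq := K3_q hyp.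
Let hk := K3_k_subfield p1 p2 q.
Let hL := K3_L_subfield p1 p2 q.

Let w : algC := (1 + 'i * sq) / 2.

(** As [q] is 3 modulo 4, [w] is a root of the integral polynomial [X^2 - X + (q + 1) / 4]. *)
Lemma trace_one_ring_of_int : ring_of_int L w.
Proof.
split.
  apply: (subfield_div hL); last exact: subfield_nat.
  apply: (subfieldD hL); first exact: subfield1.
  by apply: (subfieldM hL); [exact: K3_Li | exact: K3_Lq].
have qE : q = (4 * (q %/ 4) + 3)%N by have := K3_q_mod hyp; lia.
pose N : algC := (q %/ 4).+1%:R.
have w2 : w ^+ 2 - w + N = 0.
  have -> : w ^+ 2 - w + N = ('i ^+ 2 * sq ^+ 2 - 1) / 4 + N by rewrite /w; field.
  have qR : q%:R = 4 * (q %/ 4)%:R + 3 :> algC by rewrite [in LHS]qE natrD natrM.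
  by rewrite sqrCi sqrtn2 qR /N -natr1; field.
apply: (@root_monic_Aint ('X^2 - 'X + N%:P : {poly algC})).
- by rewrite rootE !hornerE w2.
- rewrite -addrA monicE lead_coefDl ?lead_coefXn // size_polyXn.
  rewrite (leq_ltn_trans (size_polyD _ _)) // gtn_max size_polyN size_polyX.
  by rewrite (leq_ltn_trans (size_polyC_leq1 _)).
- apply/polyOverP => i; rewrite coefD coefB coefXn coefX coefC.
  by rewrite rpredD ?rpredB ?rpred_nat //; case: ifP => _; rewrite ?rpred0 ?rpred_nat.
Qed.

Lemma trace_one_trace : w + s w = 1.
Proof.
rewrite /w fmorph_div /= rmorphD rmorphM rmorph1 rmorph_nat (K3_si hyp) (K3_sq hyp).
by field.
Qed.

Lemma K3_class I J a c u : fractional_ideal k I -> fractional_ideal k J ->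
    ext_gen L I a -> ext_gen L J (c * a * u) -> k c -> c != 0 -> int_unit L u ->
  ideal_class k J = ideal_class k I.
Proof.
move=> fI fJ eI eJ kc c0 [u0 Ou Oui].
by apply: (@ext_gen_class k L hk hL s w (K3_s_id hyp) (K3_s_fixed hyp)
  (K3_stable hyp s) (K3_invol hyp s) trace_one_ring_of_int trace_one_trace I J a c u).
Qed.

Lemma K3_principal_class I a c : fractional_ideal k I -> ext_gen L I a -> k c -> c != 0 ->
  int_unit L (a / c) -> ideal_class k I = ideal_class k (ring_of_int k).
Proof.
move=> fI eI kc c0 Uac; apply: (@K3_class _ _ 1 c (a / c)) => //.
- exact: fractional_ring_of_int.
- by apply: ext_gen_ring => //; exact: K3_kL.
- by rewrite mulr1 mulrC divfK.
Qed.

(** [s] fixes [I] pointwise and so preserves its extension; hence [s a = a * r] with [r] integral,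
    and applying [s] again gives [r * s r = 1]. *)
Lemma capitulation_unit I a : I `<=` k -> L a -> a != 0 -> ext_gen L I a ->
  int_unit L (s a / a).
Proof.
move=> Ik La a0 eI; have sa0 : s a != 0 by rewrite fmorph_eq0.
have hE := ideal_ext_submodule L I.
have sub : ideal_ext L I `<=` [set y | ideal_ext L I (s y)].
  apply: ideal_ext_min => [|x Ix /=].
    split; first split=> /=; first by rewrite rmorph0; exact: submodule0 hE.
      by move=> x y hx hy; rewrite rmorphB; exact: submoduleB hE _ _.
    move=> c x [Lc Ac] hx /=; rewrite rmorphM; apply: (submoduleM hE) => //.
    by split; [exact: (K3_stable hyp) | rewrite Aint_aut].
  by rewrite (K3_s_id hyp (Ik _ Ix)); exact: ideal_ext_sub.
have [r [Lr Ar] rE] : scale_set a (ring_of_int L) (s a).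
  by rewrite -eI; apply: sub; exact: ext_gen_mem.
have -> : s a / a = r by rewrite -rE mulrC mulKf.
have r0 : r != 0 by apply: contra_neq sa0 => r0; rewrite -rE r0 mulr0.
have srE : r^-1 = s r.
  have : s (s a) = s a * s r by rewrite -{1}rE rmorphM.
  rewrite (K3_invol hyp s La) -rE => aE; apply: (mulfI r0).
  by rewrite mulfV //; apply: (mulfI a0); rewrite mulr1 mulrA.
split=> //; rewrite srE; split; [exact: (K3_stable hyp) | by rewrite Aint_aut].
Qed.

Variables (eta b b' : algC) (I1 I2 : set algC).
Hypotheses (eta_fund : fundamental_unit m eta) (s_eta : s eta = eta^-1).
Hypotheses (Lb : L b) (Lb' : L b') (b2 : b ^+ 2 = p1%:R * eta) (b'2 : b' ^+ 2 = p2%:R * eta).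
Hypotheses (fI1 : fractional_ideal k I1) (fI2 : fractional_ideal k I2).
Hypotheses (eI1 : ext_gen L I1 b) (eI2 : ext_gen L I2 b').

(** By [capitulation_generator], a capitulating ideal has the same extension as a product of [I1]
    and [I2], up to a factor in [k]; an ideal of [k] is determined by its extension. *)
Lemma K3_kernel : capitulation_kernel k L =
  class_gen k [set ideal_class k I1; ideal_class k I2].
Proof.
have b0 := beta_neq0 hyp eta_fund b2; have b'0 := beta'_neq0 hyp eta_fund b'2.
have kL := @K3_kL p1 p2 q; apply/seteqP; split; last first.
  move=> X; apply; split; first exact: capitulation_subgroup.
  by move=> Y [->|->]; apply/(capitulationP hk hL kL) => //; [exists b | exists b'].
move=> _ [I [fI /(ideal_class_eqP _ _ hL)[a [La a0 eI]]] <-] G [[_ G1 GM _] GS].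
have Ik : I `<=` k by case: fI.
have [c [e [f [v [kc c0 Uv aE]]]]] :=
  capitulation_generator hyp eta_fund s_eta Lb b2 b'2 La a0 (capitulation_unit Ik La a0 eI).
have G1' : G (ideal_class k I1) by apply: GS; left.
have G2' : G (ideal_class k I2) by apply: GS; right.
suff [J [fJ eJ GJ]] : exists J, [/\ fractional_ideal k J,
    ext_gen L J (b ^+ e * b' ^+ f) & G (ideal_class k J)].
  by rewrite (K3_class fJ fI eJ _ kc c0 Uv) // -aE.
case: e f {aE} => [] []; rewrite ?expr0 ?expr1 ?mul1r ?mulr1.
- exists (ideal_mul I1 I2); split; [exact: fractional_ideal_mul | exact: ext_gen_mul |
  exact: GM].
- by exists I1.
- by exists I2.
- exists (ring_of_int k); split=> //; first exact: fractional_ring_of_int.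
  exact: ext_gen_ring.
Qed.

(** * The fundamental unit of Q(sqrt d) and relations between the two classes *)

Variables (x y : int).
Local Notation eps := (x%:~R + y%:~R * sd).
Hypothesis eps_fund : fundamental_unit d eps.

Lemma eps_k : int_unit k eps.
Proof.
case: eps_fund => U _ _; apply: int_unit_sub U.
by apply: field_gen_min => // _ ->; exact: K3_kd.
Qed.

(** The norm is an integer and a unit; the value -1 would give [d y^2 = x^2 + 1], impossible since
    [d] is 3 modulo 4. *)
Lemma eps_norm : eps * t eps = 1.
Proof.
have tE : t eps = x%:~R - y%:~R * sd.
  by rewrite rmorphD rmorphM !rmorph_int (K3_td hyp) mulrN.
have NE : eps * t eps = (x ^+ 2 - d%:Z * y ^+ 2)%:~R.
  by rewrite tE intr_norm_form -(sqrtn2 d); ring.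
have UL : int_unit L (eps * t eps).
  have U : int_unit L eps by apply: int_unit_sub eps_k; exact: K3_kL.
  by apply: int_unitM => //; exact: (K3_unit_aut hyp).
move: UL NE; set N := (x ^+ 2 - d%:Z * y ^+ 2) => UL NE.
have Ui : (N%:~R : algC)^-1 \in Num.int.
  apply: Cint_rat_Aint; first by rewrite rpredV rpred_int.
  by rewrite -NE; exact: int_unit_Aint (int_unitV UL).
have N0 : N%:~R != 0 :> algC by rewrite -NE; exact: int_unit_neq0 UL.
have /intrP[M ME] := Ui.
have MN : M * N = 1.
  by apply: (@intr_inj algC); rewrite rmorphM /= -ME mulVf.
have [N1|N1] : N = 1 \/ N = -1.
  have /eqP : (`|M| * `|N|)%N = 1%N by rewrite -abszM MN.
  by rewrite muln_eq1 => /andP[_ /eqP]; lia.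
  by rewrite NE N1.
(* Doubling [x] and [y] brings [d y^2 = x^2 + 1] to the form [d a^2 = b^2 + 4]. *)
exfalso; apply: (@norm_neg1_nat d (2 * `|y|) (2 * `|x|)).
  by rewrite -modnMm -(modnMm p1) (K3_p1_mod hyp) (K3_p2_mod hyp) (K3_q_mod hyp).
have E : d%:R * y%:~R ^+ 2 = x%:~R ^+ 2 + 1 :> algC.
  have := intr_norm_form x y d; rewrite -/N N1 => /esym/eqP.
  by rewrite subr_eq => /eqP ->; ring.
have En : (d * `|y| ^ 2 = (`|x| ^ 2).+1)%N.
  by apply/eqP; rewrite -(eqr_nat algC) natrM -natr1 !natr_sqr_absz E.
by rewrite !expnMn mulnCA En mulnS addnC.
Qed.

(* With [N = 1 + eps] or [N = eps - 1], one has [N^2 = 2 eps (x + 1)] or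
   [N^2 = 2 eps (x - 1)]; the factor [2 = - i (1 + i)^2] is absorbed in k. *)
Lemma eps_root c : (0 < c)%N -> pm_square c x \/ pm_square (2 * c) x ->
  exists z, [/\ k z, z != 0 & int_unit k (z ^+ 2 / c%:R)].
Proof.
move=> c0 sqx; have c0' : c%:R != 0 :> algC by rewrite pnatr_eq0 -lt0n.
have Ue := eps_k; have e0 := int_unit_neq0 Ue.
have e1 : 1 < eps by case: eps_fund.
have tE : t eps = x%:~R - y%:~R * sd.
  by rewrite rmorphD rmorphM !rmorph_int (K3_td hyp) mulrN.
have epsV : eps^-1 = x%:~R - y%:~R * sd.
  by apply: (mulfI e0); rewrite mulfV // -tE eps_norm.
have trE : eps + eps^-1 = 2 * x%:~R by rewrite epsV; ring.
have plus : (1 + eps) ^+ 2 = 2 * eps * (x + 1)%:~R.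
  rewrite rmorphD /= mulrDr -[2 * eps * _]mulrAC -trE; move: (eps) e0 => E E0.
  by field.
have minus : (eps - 1) ^+ 2 = 2 * eps * (x - 1)%:~R.
  rewrite rmorphB /= mulrBr -[2 * eps * _]mulrAC -trE; move: (eps) e0 => E E0.
  by field.
have ke : k eps by exact: int_unit_mem Ue.
have kp : k (1 + eps) by apply: (subfieldD hk) => //; exact: subfield1.
have km : k (eps - 1) by apply: (subfieldB hk) => //; exact: subfield1.
have p0 : 1 + eps != 0 by rewrite gt_eqF // addr_gt0 ?ltr01 // (lt_trans ltr01).
have m0 : eps - 1 != 0 by rewrite subr_eq0 gt_eqF.
(* The first alternative arises when [c (x +- 1)] is a square, the second when [2 c (x +- 1)] is. *)
suff [N [n [kN N0 [NE|NE]]]] : exists N (n : nat), [/\ k N, N != 0 &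
    c%:R * N ^+ 2 = 2 * eps * n%:R ^+ 2 \/ c%:R * N ^+ 2 = eps * n%:R ^+ 2].
- have n0 : n%:R != 0 :> algC.
    by apply: contra_neq N0 => n0; apply/eqP;
      rewrite -sqrf_eq0 -(mulrI_eq0 _ (mulfI c0')) NE n0 expr0n mulr0.
  have k1 : k (1 + 'i) by apply: (subfieldD hk); [exact: subfield1 | exact: K3_ki].
  have i2 : (1 + 'i) ^+ 2 = 2 * 'i :> algC by rewrite sqrrD sqrCi expr1n; ring.
  have n1 : 1 + 'i != 0 :> algC by rewrite -sqrf_eq0 i2 mulf_neq0 ?pnatr_eq0 // neq0Ci.
  exists ((1 + 'i) * n%:R / N); split.
  + apply: (subfield_div hk) => //; apply: (subfieldM hk) => //; exact: subfield_nat.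
  + by rewrite !mulf_neq0 ?invr_eq0.
  + have -> : ((1 + 'i) * n%:R / N) ^+ 2 / c%:R = 'i / eps.
      rewrite expr_div_n exprMn i2; apply/eqP; rewrite -mulrA -invfM
        eqr_div ?mulf_neq0 ?expf_neq0 //.
      by apply/eqP; rewrite [N ^+ 2 * _]mulrC NE; ring.
    apply: int_unitM => //; last exact: int_unitV.
    by apply: int_unit_root4 => //; [exact: K3_ki | rewrite (exprM _ 2 2) sqrCi sqrrN expr1n].
- have n0 : n%:R != 0 :> algC.
    by apply: contra_neq N0 => n0; apply/eqP;
      rewrite -sqrf_eq0 -(mulrI_eq0 _ (mulfI c0')) NE n0 expr0n mulr0.
  exists (n%:R / N); split.
  + by apply: (subfield_div hk) => //; exact: subfield_nat.
  + by rewrite mulf_neq0 ?invr_eq0.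
  + have -> : (n%:R / N) ^+ 2 / c%:R = eps^-1.
      rewrite expr_div_n -mulrA -invfM; apply: (mulfI e0); rewrite mulfV // mulrA -NE.
      by rewrite [N ^+ 2 * _]mulrC mulfV // mulf_neq0 // expf_neq0.
    exact: int_unitV.
have castE (n : nat) (u : int) c1 : c1%:Z * u = n%:Z ^+ 2 -> c1%:R * u%:~R = n%:R ^+ 2 :> algC.
  by move=> h; rewrite -[c1%:R]/(c1%:~R) -rmorphM /= h rmorphXn.
case: sqx => -[n [/castE h|/castE h]]; rewrite ?natrM in h.
- by exists (1 + eps), n; split=> //; left; rewrite plus -h; ring.
- by exists (eps - 1), n; split=> //; left; rewrite minus -h; ring.
- by exists (1 + eps), n; split=> //; right; rewrite plus -h; ring.
- by exists (eps - 1), n; split=> //; right; rewrite minus -h; ring.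
Qed.

(** The square of [a / z] is a unit, so [a] and [z] generate the same ideal of L, and [I] is
    [(z)]. *)
Lemma K3_principal I c a v : fractional_ideal k I -> ext_gen L I a -> L a ->
    int_unit L v -> a ^+ 2 = c * v -> c != 0 ->
    (exists z, [/\ k z, z != 0 & int_unit k (z ^+ 2 / c)]) ->
  ideal_class k I = ideal_class k (ring_of_int k).
Proof.
move=> fI eI La Uv a2 c0 [z [kz z0 Uz]]; apply: (K3_principal_class fI eI kz z0).
apply: int_unit_sqrt => //; first by apply: (subfield_div hL) => //; exact: K3_kL.
have -> : (a / z) ^+ 2 = v * (z ^+ 2 / c)^-1 by rewrite expr_div_n a2; field; rewrite ?z0 ?c0.
by apply: int_unitM => //; apply: int_unitV; apply: int_unit_sub Uz; exact: K3_kL.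
Qed.

Let c1 := ideal_class k I1.
Let c2 := ideal_class k I2.

Lemma K3_case_p1 : pm_square p1 x \/ pm_square (2 * p1) x -> c1 = ideal_class k (ring_of_int k).
Proof.
move=> /(eps_root (prime_gt0 pp1)); apply: (K3_principal fI1 eI1 Lb) b2 _.
  exact: (eta_unit hyp eta_fund).
by rewrite pnatr_eq0 -lt0n prime_gt0.
Qed.

Lemma K3_case_p2 : pm_square p2 x \/ pm_square (2 * p2) x -> c2 = ideal_class k (ring_of_int k).
Proof.
move=> /(eps_root (prime_gt0 pp2)); apply: (K3_principal fI2 eI2 Lb') b'2 _.
  exact: (eta_unit hyp eta_fund).
by rewrite pnatr_eq0 -lt0n prime_gt0.
Qed.

(** [b * b'] squares to [m] times a unit, and [m = d / q] is, like [q], a square in [k] up to units,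
    since [d] is a square in [k]. *)
Lemma K3_case_q : pm_square q x \/ pm_square (2 * q) x ->
  ideal_class k (ideal_mul I1 I2) = ideal_class k (ring_of_int k).
Proof.
move=> /(eps_root (prime_gt0 pq))[z [kz z0 Uz]].
have q0 : q%:R != 0 :> algC by rewrite pnatr_eq0 -lt0n prime_gt0.
have m0 : m%:R != 0 :> algC by rewrite pnatr_eq0 -lt0n muln_gt0 !prime_gt0.
have Ue := eta_unit hyp eta_fund.
have bb2 : (b * b') ^+ 2 = m%:R * eta ^+ 2 by rewrite exprMn b2 b'2 natrM; ring.
apply: (K3_principal (fractional_ideal_mul hk fI1 fI2) (ext_gen_mul hL eI1 eI2)
  (subfieldM hL Lb Lb') (int_unitX 2 hL Ue) bb2 m0).
exists (sd * z / q%:R); split.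
- apply: (subfield_div hk); last exact: subfield_nat.
  by apply: (subfieldM hk) => //; exact: K3_kd.
- by rewrite !mulf_neq0 ?invr_eq0 // sqrtn_neq0 // (K3_d_gt0 hyp).
- have -> : (sd * z / q%:R) ^+ 2 / m%:R = z ^+ 2 / q%:R.
    rewrite expr_div_n exprMn sqrtn2 natrM; move: (m%:R) m0 => M M0.
    by field; rewrite ?q0 ?M0.
  by [].
Qed.

Lemma class_gen_eq S S' :
    (forall G, class_subgroup k G -> S `<=` G <-> S' `<=` G) -> class_gen k S = class_gen k S'.
Proof.
move=> h; apply/seteqP; split=> X gX G [hG SG]; apply: gX; split=> //.
  by have [_] := h _ hG; exact.
by have [] := h _ hG => + _; exact.
Qed.

Lemma K3_cases :
  [/\ pm_square 1 x -> capitulation_kernel k L = class_gen k [set c1; c2],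
      pm_square p1 x \/ pm_square (2 * p1) x -> capitulation_kernel k L = class_gen k [set c2],
      pm_square p2 x \/ pm_square (2 * p2) x -> capitulation_kernel k L = class_gen k [set c1]
    & pm_square q x \/ pm_square (2 * q) x ->
        capitulation_kernel k L = class_gen k [set c1] /\
        capitulation_kernel k L = class_gen k [set c2]].
Proof.
rewrite K3_kernel -/c1 -/c2; split=> [//|/K3_case_p1 e|/K3_case_p2 e|/K3_case_q e].
- apply: class_gen_eq => G [_ G1 _ _]; split=> [h X ->|h X [->|]]; [by apply: h; right |
  by rewrite e | exact: h].
- apply: class_gen_eq => G [_ G1 _ _]; split=> [h X ->|h X [|->]]; [by apply: h; left |
  exact: h | by rewrite e].
- split; apply: class_gen_eq => G [_ G1 GM GV].
    split=> [h X ->|h X [|->]]; [by apply: h; left | exact: h |].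
    by apply: (GV I1 I2) => //; exact: h.
  split=> [h X ->|h X [->|]]; [by apply: h; right | | exact: h].
  by apply: (GV I2 I1) => //; [rewrite ideal_mulC | exact: h].
Qed.

End K3Kernel.

Theorem theorem5p6 (p1 p2 q e f g h : nat) (x y : int) (eta : algC)
    (H1 H2 H3 H4 : set algC)
    (p1_prime : prime p1) (p2_prime : prime p2) (q_prime : prime q)
    (p1_neq_p2 : p1 <> p2) (p1_neq_q : p1 <> q) (p2_neq_q : p2 <> q)
    (p1_mod4 : (p1%:Z = 1 %[mod 4])%Z)
    (p2_mod4 : (p2%:Z = 1 %[mod 4])%Z)
    (q_mod4 : (- q%:Z = 1 %[mod 4])%Z)
    (p1_eq : p1 = (e ^ 2 + 4 * f ^ 2)%N)
    (p2_eq : p2 = (g ^ 2 + 4 * h ^ 2)%N)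
    (H1_above : prime_lying_above (field_k p1 p2 q) H1 (e%:R + 2 * 'i * f%:R))
    (H2_above : prime_lying_above (field_k p1 p2 q) H2 (e%:R - 2 * 'i * f%:R))
    (H3_above : prime_lying_above (field_k p1 p2 q) H3 (g%:R + 2 * 'i * h%:R))
    (H4_above : prime_lying_above (field_k p1 p2 q) H4 (g%:R - 2 * 'i * h%:R))
    (eps_fund : fundamental_unit (p1 * p2 * q)
                  (x%:~R + y%:~R * sqrtn (p1 * p2 * q)))
    (eta_fund : fundamental_unit (p1 * p2) eta)
    (eta_norm : quad_norm_eq (p1 * p2) eta 1) :
  let k := field_k p1 p2 q in
  let kappa := capitulation_kernel k (field_K3 p1 p2 q) in
  let c12 := ideal_class k (ideal_mul H1 H2) in
  let c34 := ideal_class k (ideal_mul H3 H4) in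
  [/\ pm_square 1 x -> kappa = class_gen k [set c12; c34],
      pm_square p1 x \/ pm_square (2 * p1) x -> kappa = class_gen k [set c34],
      pm_square p2 x \/ pm_square (2 * p2) x -> kappa = class_gen k [set c12]
    & pm_square q x \/ pm_square (2 * q) x ->
        kappa = class_gen k [set c12] /\ kappa = class_gen k [set c34]].
Proof.
have m4 (p : nat) : (p%:Z = 1 %[mod 4])%Z -> (p %% 4 = 1)%N by lia.
have q4 : (q %% 4 = 3)%N by lia.
have [s [t hyp]] := K3_setting_exists p1_prime p2_prime q_prime p1_neq_p2 p1_neq_q
  p2_neq_q (m4 _ p1_mod4) (m4 _ p2_mod4) q4.
have odd4 (p : nat) : (p %% 4 = 1)%N -> odd p by lia.
have p1_odd := odd4 _ (K3_p1_mod hyp); have p2_odd := odd4 _ (K3_p2_mod hyp).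
(* This is norm one read through [s], which restricts to the nontrivial automorphism of Q(sqrt
   m). *)
have s_eta : s eta = eta^-1.
  case: eta_norm => a [b [-> N1]].
  rewrite rmorphD fmorph_rat rmorphM fmorph_rat (K3_sm hyp) mulrN.
  rewrite rmorph1 in N1; have e0 : ratr a + ratr b * sqrtn (p1 * p2) != 0.
    by apply/eqP => e0; move/eqP: N1; rewrite e0 mul0r oner_eq0.
  by apply: (mulfI e0); rewrite -N1 mulfV.
have [b [b' [Lb Lb' b2 b'2]]] := eta_roots hyp eta_fund s_eta.
have Ue := eta_unit hyp eta_fund.
have d1 : (p1 * p2 * q = p1 * (p2 * q))%N by rewrite mulnA.
have d2 : (p1 * p2 * q = p2 * (p1 * q))%N by rewrite mulnCA mulnA.
have cop (p r : nat) : prime p -> prime r -> p <> r -> coprime p r.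
  by move=> pp pr pr'; rewrite prime_coprime // dvdn_prime2 //; apply/eqP.
have cop1 : coprime p1 (p2 * q) by rewrite coprimeMr !cop.
have cop2 : coprime p2 (p1 * q) by rewrite coprimeMr !cop // => /esym.
move=> k kappa c12 c34.
(* [H1 H2] and [H3 H4] take the places of [I1] and [I2], with generators [b] and [b'] in L. *)
apply: (K3_cases hyp eta_fund s_eta Lb Lb' b2 b'2 _ _ _ _ eps_fund).
- exact: above_fractional H1_above H2_above.
- exact: above_fractional H3_above H4_above.
- exact: (above_ext_gen hyp d1 p1_prime p1_odd cop1 p1_eq H1_above H2_above Lb Ue b2).
- exact: (above_ext_gen hyp d2 p2_prime p2_odd cop2 p2_eq H3_above H4_above Lb' Ue b'2).
Qed.
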